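(* For every infinite-dimensional Banach space $X$ over $\mathbb{K}$ ($=\mathbb{R}$ or $\mathbb{C}$), there exist a Banach space $Y$ over $\mathbb{K}$ containing $X$ isometrically as a hyperplane, and a bounded linear operator $T:X\to Y$, such that $$\overline{W_{i_{X,Y}}(T)}\neq\widetilde{W}_{i_{X,Y}}(T),$$ where $i_{X,Y}:S_X\to Y$ is the inclusion map and $T$ is identified with its restriction to $S_X$.
   Context: $S_X$ and $S_{Y^*}$ are the unit spheres of $X$ and of the topological dual $Y^*$ of $Y$. $\mathrm{Re}$ denotes the real part in the complex case and the identity in the real case. $\ell_\infty(\Gamma,Y)$ is the Banach space of all bounded functions from a non-empty set $\Gamma$ into $Y$ with the supremum norm. For $g\in\ell_\infty(\Gamma,Y)$ with $\|g\|=1$ and $f\in \ell_\infty(\Gamma,Y)$: The spatial numerical range of $f$ relative to $g$ is $$W_g(f):=\{y^*(f(t)) : y^*\in S_{Y^*},\ t\in\Gamma,\ y^*(g(t))=1\}.$$ The approximated spatial numerical range of $f$ relative to $g$ is $$\widetilde{W}_g(f):=\bigcap_{\varepsilon>0}\overline{\{y^*(f(t)) : y^*\in S_{Y^*},\ t\in\Gamma,\ \mathrm{Re}\,y^*(g(t))>1-\varepsilon\}}.$$ Here these are used with $\Gamma=S_X$, $g=i_{X,Y}$ and $f=T|_{S_X}$. A hyperplane is a closed subspace of codimension one. *)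

(* Defs.v *)
From HB Require Import structures.
From mathcomp Require Import all_boot all_order all_algebra.
From mathcomp Require Import complex.
From mathcomp Require Import all_classical all_reals topology normedtype.

Set Implicit Arguments.
Unset Strict Implicit.
Unset Printing Implicit Defensive.

Import Order.TTheory GRing.Theory Num.Theory.
Import numFieldNormedType.Exports.

Local Open Scope classical_set_scope.
Local Open Scope ring_scope.

Variant scalar_kind := RealScalars | ComplexScalars.

Definition scalars (R : realType) (k : scalar_kind) : numFieldType :=
  match k with
  | RealScalars => R
  | ComplexScalars => R[i]
  end.

(* Norms of normed modules over K take their values in K itself; [re] also
   serves to read such a norm as an element of R. *)
Definition re (R : realType) (k : scalar_kind) : scalars R k -> R :=
  match k with
  | RealScalars => fun x : R => x
  | ComplexScalars => fun z : R[i] => complex.Re z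
  end.
Arguments re {R k} _.

Definition finite_dimensional (K : numFieldType) (X : lmodType K) : Prop :=
  exists (n : nat) (v : 'I_n -> X),
    forall x : X, exists c : 'I_n -> K, x = \sum_(i < n) c i *: v i.

Definition unit_sphere (K : numFieldType) (X : normedModType K) : set X :=
  [set x | `|x| = 1].
Arguments unit_sphere {K} X _.

(* The last clause says that the quotient by H is one-dimensional: it is
   spanned by the class of e, and this class is nonzero. *)
Definition hyperplane (K : numFieldType) (Y : normedModType K) (H : set Y) :
    Prop :=
  [/\ closed H,
      H 0,
      forall (a : K) (x y : Y), H x -> H y -> H (a *: x + y) &
      exists e : Y, ~ H e /\ forall y : Y, exists a : K, H (y - a *: e)].

Definition bounded_operator (K : numFieldType) (X Y : normedModType K)
    (T : {linear X -> Y}) : Prop :=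
  exists M : K, forall x : X, `|T x| <= M * `|x|.

Section NumericalRanges.
Variables (R : realType) (k : scalar_kind).
Local Notation K := (scalars R k).

Definition dual_norm (Y : normedModType K) (phi : {linear Y -> K^o}) : R :=
  sup [set re `|phi y| | y in [set y : Y | `|y| <= 1]].

Definition dual_unit_sphere (Y : normedModType K) : set {linear Y -> K^o} :=
  [set phi : {linear Y -> K^o} | continuous phi /\ dual_norm phi = 1].

Definition num_range (Gamma : Type) (Y : normedModType K)
    (g f : Gamma -> Y) : set K^o :=
  [set z | exists (phi : {linear Y -> K^o}) (t : Gamma),
     [/\ dual_unit_sphere phi, phi (g t) = 1 & z = phi (f t)]].

Definition approx_num_range (Gamma : Type) (Y : normedModType K)
    (g f : Gamma -> Y) : set K^o :=
  \bigcap_(eps in [set eps : R | 0 < eps])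
    closure [set z : K^o | exists (phi : {linear Y -> K^o}) (t : Gamma),
      [/\ dual_unit_sphere phi, 1 - eps < re (phi (g t)) & z = phi (f t)]].

End NumericalRanges.

Definition restr_sphere (K : numFieldType) (X Y : normedModType K)
    (T : X -> Y) : unit_sphere X -> Y := fun t => T (\val t).

(* Main.v *)
Require Import Defs.
From HB Require Import structures.
From mathcomp Require Import all_boot all_order all_algebra.
From mathcomp Require Import complex.
From mathcomp Require Import all_classical all_reals topology normedtype.
From mathcomp Require Import sequences.
From mathcomp Require Import ring lra.

Import Order.TTheory GRing.Theory Num.Theory.
Import numFieldNormedType.Exports.

Local Open Scope classical_set_scope.
Local Open Scope ring_scope.

(** Write the norm of the superspace [Y = X x K] as
    [|(x, a)| = max(|x|, p x + |a|)], where [p] is a seminorm on [X] dominated by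
    the norm, and let [T x = (0, F x)] for a bounded functional [F] on [X].

    A norm-one functional on [Y] restricts on [0 x K] to a multiplication by some
    scalar [lam], and its value at [T x] is [lam * F x].  If it equals one at
    [(x, 0)] with [|x| = 1] and if [p x < 1], then the norm of [Y] does not change
    when [(x, 0)] is moved a little in the direction [(0, 1)]; this forces
    [lam = 0], so that the spatial numerical range of [T] is contained in [{0}].
    On the other hand, if [|x| = 1] and [p x] is close to one, a functional [U]
    dominated by [p] with [U x = p x] extends with any [lam] of modulus one, and
    then [|F x|] is an almost attained value.  So it is enough to find [p] and [F]
    such that [p < 1] on the unit sphere, while [p] is close to one at points of
    the sphere at which [|F|] stays above a positive constant (definition
    [witness]).

    Such a pair exists on every infinite-dimensional [X], by the dichotomy
    [nonattaining_or_compact].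

    - Either some functional [u] of norm one does not attain its norm; then
      [p = |u|] and [F = u] work.
    - Or every sequence in the dual ball has a pointwise convergent subsequence.
      Differences of a separated sequence of functionals then give norm-one
      functionals [v_n] that tend to zero pointwise, and the seminorms
      [c_n |v_n|], with [c_n] increasing to one, have a supremum below one at
      each point of the unit ball.  To find [F], one asks whether adding some
      finite sum [q] of the [|v_i|], normalised to be at most one, increases the
      norm of infinitely many [|v_n|] by a fixed amount.  If it does, the points
      where [|v_n| + q] is large are points where [q] is large, hence where one of
      the [|v_i|] is ([witness_heavy]).  If it never does, a subsequence has
      absolute sums close to one on the unit ball, its sum [F] is a bounded
      functional, and [F] is close to [v_n] where [v_n] is close to one
      ([witness_light]).

    The dichotomy is a form of James's theorem.  Say that a sequence [f] in the
    dual ball has a gap [theta] if no functional [g] in the dual ball satisfies,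
    along any of its subsequences, [g x - theta <= f_n x] eventually for each [x]
    in the unit ball.  If no sequence has a subsequence with a gap, a diagonal
    argument yields pointwise convergent subsequences.  If there is one, James's
    inductive choice of convex combinations produces a functional that does not
    attain its norm ([james_functional]). *)

(** * Sublinear functionals and the Hahn-Banach theorem *)
Section RealFunctionals.
Context {R : realType} {V : lmodType R}.
Implicit Types (p q : V -> R) (f : V -> R).

Definition functional f := forall a x y, f (a *: x + y) = a * f x + f y.

Definition sublinear p :=
  (forall x y, p (x + y) <= p x + p y) /\
  (forall a x, 0 < a -> p (a *: x) = a * p x).

Definition seminorm p :=
  (forall x y, p (x + y) <= p x + p y) /\
  (forall a x, p (a *: x) = `|a| * p x).

Lemma functional0 f : functional f -> f 0 = 0.
Proof. by move=> /(_ (-1) 0 0); rewrite scaler0 addr0 mulN1r addNr. Qed.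

Lemma functionalZ f a x : functional f -> f (a *: x) = a * f x.
Proof. by move=> fl; have := fl a x 0; rewrite !addr0 (functional0 _ fl) addr0. Qed.

Lemma functionalN f x : functional f -> f (- x) = - f x.
Proof. by move=> fl; rewrite -scaleN1r functionalZ// mulN1r. Qed.

Lemma functional_comb f g a b : functional f -> functional g ->
  functional (fun x => a * f x + b * g x).
Proof. by move=> fl gl c x y; rewrite fl gl; ring. Qed.

Lemma seminorm_sublinear p : seminorm p -> sublinear p.
Proof. by case=> pD pZ; split=> // a x a0; rewrite pZ gtr0_norm. Qed.

Lemma seminorm0 p : seminorm p -> p 0 = 0.
Proof. by case=> _ pZ; rewrite -(scale0r 0) pZ normr0 mul0r. Qed.

Lemma seminormN p x : seminorm p -> p (- x) = p x.
Proof. by case=> _ pZ; rewrite -scaleN1r pZ normrN1 mul1r. Qed.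

Lemma seminorm_ge0 p x : seminorm p -> 0 <= p x.
Proof.
move=> pS; have := pS.1 x (- x); rewrite subrr (seminorm0 _ pS) seminormN//.
lra.
Qed.

Lemma sublinear0 p : sublinear p -> p 0 = 0.
Proof.
by case=> _ /(_ 2 0 ltac:(by rewrite ltr0n)); rewrite scaler0; lra.
Qed.

Lemma sublinearN p x : sublinear p -> - p (- x) <= p x.
Proof.
move=> ps; have := ps.1 x (- x); rewrite subrr (sublinear0 _ ps); lra.
Qed.

Lemma functional_norm_le f p x : seminorm p -> functional f ->
  (forall x, f x <= p x) -> `|f x| <= p x.
Proof.
move=> ps fl fp; rewrite ler_norml fp andbT.
by have := fp (- x); rewrite functionalN// seminormN// lerNl.
Qed.

(** The largest sublinear functional below [p] whose value at [- y] is at most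
    [- p y]. *)
Definition lowering p y := fun x => inf [set p (x + t *: y) - t * p y | t in [set t : R | 0 <= t]].

Lemma lowering_lb p y x t : sublinear p -> 0 <= t -> - p (- x) <= p (x + t *: y) - t * p y.
Proof.
move=> ps t0; have pt : p (t *: y) = t * p y.
  move: t0; rewrite le_eqVlt => /predU1P[<-|t0]; last exact: ps.2.
  by rewrite scale0r mul0r sublinear0.
have := ps.1 (x + t *: y) (- x).
rewrite addrAC subrr add0r pt; lra.
Qed.

Lemma lowering_le p y x t : sublinear p -> 0 <= t -> lowering p y x <= p (x + t *: y) - t * p y.
Proof.
move=> ps t0; apply: ge_inf; last by exists t.
by exists (- p (- x)) => _ [s s0 <-]; exact: lowering_lb.
Qed.

Lemma le_lowering p y x c : (forall t : R, 0 <= t -> c <= p (x + t *: y) - t * p y) -> c <= lowering p y x.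
Proof.
move=> H; apply: lb_le_inf; first by exists (p (x + 0 *: y) - 0 * p y); exists 0 => /=.
by move=> _ [t t0 <-]; exact: H.
Qed.

Lemma lowering_le_self p y x : sublinear p -> lowering p y x <= p x.
Proof.
by move=> ps; have := lowering_le p y x 0 ps (lexx 0); rewrite scale0r addr0 mul0r subr0.
Qed.

Lemma lowering_opp p y : sublinear p -> lowering p y (- y) <= - p y.
Proof.
move=> ps; have := lowering_le p y (- y) 1 ps ler01.
by rewrite scale1r addNr mul1r sublinear0// sub0r.
Qed.

Lemma sublinear_lowering p y : sublinear p -> sublinear (lowering p y).
Proof.
move=> ps.
have sub x z : lowering p y (x + z) <= lowering p y x + lowering p y z.
  suff: lowering p y (x + z) - lowering p y z <= lowering p y x by lra.
  apply: le_lowering => t t0.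
  suff: lowering p y (x + z) - (p (x + t *: y) - t * p y) <= lowering p y z by lra.
  apply: le_lowering => s s0.
  suff: lowering p y (x + z) <= p (z + s *: y) - s * p y + (p (x + t *: y) - t * p y) by lra.
  apply: (le_trans (lowering_le p y _ _ ps (addr_ge0 s0 t0))).
  have := ps.1 (z + s *: y) (x + t *: y).
  have -> : z + s *: y + (x + t *: y) = x + z + (s + t) *: y.
    by rewrite scalerDl addrACA (addrC z).
  by lra.
have hom a x : 0 < a -> lowering p y (a *: x) <= a * lowering p y x.
  move=> a0; rewrite -ler_pdivrMl//; apply: le_lowering => t t0.
  rewrite ler_pdivrMl//.
  apply: (le_trans (lowering_le p y _ _ ps (mulr_ge0 (ltW a0) t0))).
  by rewrite -scalerA -scalerDr ps.2// mulrBr mulrA.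
split=> // a x a0; apply/eqP; rewrite eq_le hom//=.
have ai0 : 0 < a^-1 by rewrite invr_gt0.
have := hom _ (a *: x) ai0; rewrite scalerA mulVf ?gt_eqF// scale1r.
by rewrite ler_pdivlMl.
Qed.

(** The infimum of a chain of sublinear functionals below [p] is sublinear:
    finiteness comes from [- p (- x) <= q x], and for the triangle inequality two
    members of the chain can be replaced with the smaller one. *)
Lemma minimal_sublinear p : sublinear p -> exists q, [/\ sublinear q,
  (forall x, q x <= p x) & forall q', sublinear q' -> (forall x, q' x <= q x) -> q' = q].
Proof.
move=> ps.
pose T := {q : V -> R | sublinear q /\ forall x, q x <= p x}.
pose le (q1 q2 : T) := `[< forall x, sval q2 x <= sval q1 x >].
have [||||[q [qs qp]] qm] := @Zorn T le.
- by move=> q; apply/asboolP.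
- by move=> q1 q2 q3 /asboolP h1 /asboolP h2; apply/asboolP => x; apply: le_trans (h1 x).
- move=> [q1 +] [q2 +] /asboolP/= h1 /asboolP/= h2.
  suff -> : q1 = q2 by move=> H1 H2; congr exist.
  apply/funext => x; by apply/eqP; rewrite eq_le h1 h2.
- move=> C tot; have [[q0 Cq0]|C0] := pselect (exists q : T, C q); last first.
    exists (exist (fun q => sublinear q /\ forall x, q x <= p x) p
      (conj ps (fun=> lexx _))) => q1 Cq; case: C0; by exists q1.
  pose I x := (fun q1 : T => sval q1 x) @` C.
  have Ilb x : has_inf (I x).
    split; first by exists (sval q0 x); exists q0.
    exists (- p (- x)) => _ [q Cq <-]; have [qs qp] := svalP q.
    by apply: le_trans (sublinearN _ x qs); rewrite lerN2.
  have Ile (q : T) x : C q -> inf (I x) <= sval q x.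
    by move=> Cq; apply: ge_inf; [exact: (Ilb x).2|exists q].
  have leI c x : (forall q : T, C q -> c <= sval q x) -> c <= inf (I x).
    by move=> H; apply: lb_le_inf; [exact: (Ilb x).1|move=> _ [q Cq <-]; exact: H].
  have infS : sublinear (fun x => inf (I x)).
    have hom a x : 0 < a -> inf (I (a *: x)) <= a * inf (I x).
      move=> a0; rewrite -ler_pdivrMl//; apply: leI => q Cq; rewrite ler_pdivrMl//.
      by rewrite -(svalP q).1.2//; exact: Ile.
    split=> [x y|a x a0]; last first.
      apply/eqP; rewrite eq_le hom//=.
      have ai0 : 0 < a^-1 by rewrite invr_gt0.
      have := hom _ (a *: x) ai0; rewrite scalerA mulVf ?gt_eqF// scale1r.
      by rewrite ler_pdivlMl.
    have key (q1 q2 : T) : C q1 -> C q2 -> inf (I (x + y)) <= sval q1 x + sval q2 y.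
      move=> Cq1 Cq2; have [/asboolP h|/asboolP h] := tot _ _ Cq1 Cq2.
        apply: (le_trans (Ile _ _ Cq2)); apply: (le_trans ((svalP q2).1.1 x y)).
        by rewrite lerD2r; exact: h.
      apply: (le_trans (Ile _ _ Cq1)); apply: (le_trans ((svalP q1).1.1 x y)).
      by rewrite lerD2l; exact: h.
    have key' (q1 : T) : C q1 -> inf (I (x + y)) - sval q1 x <= inf (I y).
      by move=> Cq1; apply: leI => q2 Cq2; rewrite lerBlDl; exact: key.
    rewrite -lerBlDr; apply: leI => q1 Cq1.
    by rewrite lerBlDr -lerBlDl; exact: key'.
  have ip x : inf (I x) <= p x by apply: (le_trans (Ile _ x Cq0)); exact: (svalP q0).2.
  by exists (exist (fun q => sublinear q /\ forall x, q x <= p x) _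
    (conj infS ip)) => q Cq; apply/asboolP => x /=; exact: Ile.
exists q; split=> // q' q's q'q.
have q'p x : q' x <= p x by exact: le_trans (q'q x) (qp x).
have := qm (exist (fun q => sublinear q /\ forall x, q x <= p x) q' (conj q's q'p)).
by move=> /(_ ltac:(by apply/asboolP)) [].
Qed.

(** A minimal sublinear functional is equal to all its lowerings, hence odd and
    so linear.  Starting from the lowering of [p] at [x0] gives [f x0 = p x0]. *)
Lemma hahn_banach p x0 : sublinear p ->
  exists f, [/\ functional f, forall x, f x <= p x & f x0 = p x0].
Proof.
move=> ps; have [f [fs fp fm]] := minimal_sublinear _ (sublinear_lowering p x0 ps).
have lowE y : lowering f y = f.
  by apply: fm; [exact: sublinear_lowering|move=> x; exact: lowering_le_self].
have fN y : f (- y) = - f y.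
  have := lowering_opp f y fs; rewrite lowE => h.
  by apply/eqP; rewrite eq_le h /=; have := sublinearN _ (- y) fs; rewrite opprK; lra.
have fD x y : f (x + y) = f x + f y.
  apply/eqP; rewrite eq_le fs.1 /=.
  by have := fs.1 (- x) (- y); rewrite -opprD !fN; lra.
have fZ a x : f (a *: x) = a * f x.
  have [a0|a0|<-] := ltrgtP 0 a; first exact: fs.2.
    by rewrite -(opprK a) scaleNr fN fs.2 ?oppr_gt0// [RHS]mulNr.
  by rewrite scale0r mul0r sublinear0.
exists f; split=> [a x y|x|]; first by rewrite fD fZ.
  by apply: le_trans (fp x) _; exact: lowering_le_self.
apply/eqP; rewrite eq_le; apply/andP; split.
  by apply: le_trans (fp x0) _; exact: lowering_le_self.
have := le_trans (fp (- x0)) (lowering_opp p x0 ps); rewrite fN; lra.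
Qed.

(** Limit along an ultrafilter on the indices: by compactness of segments it
    exists at every point, and it is linear. *)
Lemma cluster_functional p (f : nat -> V -> R) :
  (forall n, functional (f n)) -> (forall n x, `|f n x| <= p x) ->
  exists w, functional w /\
    forall x a N, (forall n, (N <= n)%N -> a <= f n x) -> a <= w x.
Proof.
move=> fl fb.
have [U [UU finU]] := ultraFilterLemma (eventually_filter).
have ex x : exists l : R, f n x @[n --> U] --> l.
  have [|l [_ ll]] := @segment_compact R (- p x) (p x) (f n x @[n --> U]) _.
    by apply: finU; exists 0%N => // n _ /=; rewrite in_itv/= -ler_norml.
  exists l => A lA; have [//|UA] := in_ultra_setVsetC ((f ^~ x) @^-1` A) UU.
  have [y [/= yA Ay]] := ll (~` A) A UA lA.
  by [].
have [w wP] := choice ex; exists w; split=> [a x y|x a N h].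
  have := wP (a *: x + y); under eq_fun do rewrite fl.
  move/(cvg_lim (@Rhausdorff R)) => <-; apply/(cvg_lim (@Rhausdorff R)).
  by apply: cvgD => //; apply: cvgMr.
by apply: (cvgr_to_ge (wP x)); apply: finU; exists N => // n; exact: h.
Qed.
End RealFunctionals.

(** * Diagonal subsequences *)
Definition unbounded (A : set nat) := forall N, exists n, (N <= n)%N /\ A n.

Definition strictly_increasing (s : nat -> nat) := forall n, (s n < s n.+1)%N.

Lemma strictly_increasing_lt s m n : strictly_increasing s -> (m < n)%N -> (s m < s n)%N.
Proof.
by move=> h; elim: n => // n IH; rewrite ltnS leq_eqVlt => /predU1P[->//|/IH/ltn_trans]; apply; exact: h.
Qed.

Lemma strictly_increasing_ge s n : strictly_increasing s -> (n <= s n)%N.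
Proof. by move=> h; elim: n => // n /leq_ltn_trans; apply; exact: h. Qed.

Lemma strictly_increasing_le s m n : strictly_increasing s -> (s m <= s n)%N -> (m <= n)%N.
Proof.
move=> h; rewrite leqNgt => H; rewrite leqNgt; apply: contra H.
exact: strictly_increasing_lt.
Qed.

(** Take the [n]-th index in the [n]-th set of a decreasing sequence of infinite
    sets that achieve [P 0], [P 1] and so on: the range is contained in each of
    them, up to finitely many elements. *)
Lemma diagonal (P : nat -> set nat -> Prop) (A0 : set nat) :
  (forall j A, unbounded A -> A `<=` A0 -> exists B, [/\ B `<=` A, unbounded B & P j B]) ->
  (forall j (A B : set nat), (exists N, forall n, (N <= n)%N -> B n -> A n) -> P j A -> P j B) ->
  unbounded A0 ->
  exists s, [/\ strictly_increasing s, forall n, A0 (s n) & forall j, P j (range s)].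
Proof.
move=> Pex Psub A0u.
pose T := {A : set nat | unbounded A /\ A `<=` A0}.
have step (jA : nat * T) : exists B : T, sval B `<=` sval jA.2 /\ P jA.1 (sval B).
  case: jA => j [A [Au AA0]] /=.
  have [B [BA Bu PB]] := Pex j A Au AA0.
  exists (exist (fun A => unbounded A /\ A `<=` A0) B (conj Bu (subset_trans BA AA0))).
  by split.
have [nxt nxtP] := choice step.
pose F := fix F n : T := if n is m.+1 then nxt (m, F m)
  else exist (fun A => unbounded A /\ A `<=` A0) A0 (conj A0u (@subset_refl _ _)).
have FS n : sval (F n.+1) `<=` sval (F n) by exact: (nxtP (n, F n)).1.
have FP n : P n (sval (F n.+1)) by exact: (nxtP (n, F n)).2.
have Fle m n : (m <= n)%N -> sval (F n) `<=` sval (F m).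
  elim: n => [|n IH]; first by rewrite leqn0 => /eqP ->.
  rewrite leq_eqVlt => /predU1P[->//|/IH]; apply: subset_trans; exact: FS.
have pick (nN : nat * nat) : exists m, (nN.2 <= m)%N /\ sval (F nN.1.+1) m.
  exact: (svalP (F nN.1.+1)).1.
have [pk pkP] := choice pick.
pose s := fix s n := if n is m.+1 then pk (m.+1, (s m).+1) else pk (0%N, 0%N).
have sF n : sval (F n.+1) (s n).
  by case: n => [|n]; [have [_] := pkP (0%N, 0%N)|have [_] := pkP (n.+1, (s n).+1)].
have sS : strictly_increasing s by move=> n; exact: (pkP (n.+1, (s n).+1)).1.
exists s; split=> // [n|j]; first exact: (svalP (F n.+1)).2.
apply: Psub (FP j); exists (s j) => m + [n _ sn]; rewrite -sn => /(strictly_increasing_le _ _ _ sS) jn.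
exact: (Fle j.+1 n.+1).
Qed.

Lemma enumeration (A : set nat) : unbounded A -> exists s, strictly_increasing s /\ forall n, A (s n).
Proof.
move=> Au; have [|//|//|s [s1 s2 _]] := diagonal (fun=> setT) A; last by exists s.
by move=> _ B Bu _; exists B; split.
Qed.

Section Along.
Context {R : realType}.
Implicit Types (u : nat -> R).

Definition cvg_along (A : set nat) u l :=
  forall e, 0 < e -> exists N, forall n, (N <= n)%N -> A n -> `|u n - l| <= e.

Lemma cvg_along_sub A B u l : (exists N, forall n, (N <= n)%N -> B n -> A n) ->
  cvg_along A u l -> cvg_along B u l.
Proof.
move=> [N BA] ul e e0; have [M uM] := ul e e0; exists (maxn N M) => n.
by rewrite geq_max => /andP[Nn Mn] /(BA _ Nn); exact: uM.
Qed.

Lemma bounded_cvg_along A u C : unbounded A -> (forall n, `|u n| <= C) ->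
  exists B l, [/\ B `<=` A, unbounded B & cvg_along B u l].
Proof.
move=> Au uC; have [s [sS sA]] := enumeration A Au.
have [|f fS /cvg_ex[l ul]] := @bolzano_weierstrass R (u \o s).
  by exists C; split; [exact: num_real|move=> x Cx n _ /=; exact: le_trans (uC _) (ltW Cx)].
have fS' : strictly_increasing f by move=> n; have /increasing_seqP := fS; exact.
exists (range (s \o f)), l; split=> [_ [n _ <-]|N|e e0]; first exact: sA.
  exists (s (f N)); split; last by exists N.
  apply: leq_trans (strictly_increasing_ge f N fS') _; exact: strictly_increasing_ge.
move: ul => /cvgrPdist_le/(_ e e0)[N _ HN]; exists (s (f N)) => m + [n _ sn]; rewrite -sn.
move=> /(strictly_increasing_le _ _ _ sS) /(strictly_increasing_le _ _ _ fS') Nn.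
by rewrite distrC; exact: HN.
Qed.

End Along.

Section Dichotomy.
Context {R : realType} {V : lmodType R} {nrm : V -> R} (nrmS : seminorm nrm).
Implicit Types (f : nat -> V -> R) (g h : V -> R).

Definition dual_ball g := functional g /\ forall x, g x <= nrm x.

Lemma dual_ball_norm g x : dual_ball g -> `|g x| <= nrm x.
Proof. by move=> [gl gn]; exact: functional_norm_le. Qed.

Definition convex_closed (C : set (V -> R)) := forall (t : R) g h, 0 <= t <= 1 -> C g -> C h ->
  C (fun x => t * g x + (1 - t) * h x).

(** Stated by its universal property, so that no finite combination has to be
    written down. *)
Definition hull (F : set (V -> R)) g := forall C, convex_closed C -> F `<=` C -> C g.

Lemma hull_convex F : convex_closed (hull F).
Proof. by move=> t g h t01 gF hF C CC FC; apply: (CC) => //; [exact: gF|exact: hF]. Qed.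

Lemma sub_hull F : F `<=` hull F.
Proof. by move=> g Fg C _ FC; exact: FC. Qed.

Lemma hull_mono F G : F `<=` G -> hull F `<=` hull G.
Proof. by move=> FG g Fg C CC GC; apply: Fg => //; exact: subset_trans FG GC. Qed.

Lemma dual_ball_convex : convex_closed dual_ball.
Proof.
move=> t g h /andP[t0 t1] [gl gn] [hl hn]; split; first exact: functional_comb.
move=> x; have -> : nrm x = t * nrm x + (1 - t) * nrm x by ring.
by rewrite lerD// ler_wpM2l// subr_ge0.
Qed.

Lemma hull_dual_ball F : F `<=` dual_ball -> hull F `<=` dual_ball.
Proof. by move=> FB g; move=> gF; apply: gF => //; exact: dual_ball_convex. Qed.

(** The point [z] nearly maximises [h x - liminf f_n x] over the unit ball, for the
    lower limit along [A], and [f_n z] converges along [B] to nearly that lower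
    limit.  At the other points, passing to a subsequence only increases the
    lower limits. *)
Lemma almost_optimal_point f h C A e : (forall n, dual_ball (f n)) ->
  (forall x, nrm x <= 1 -> `|h x| <= C) -> 0 < e -> unbounded A ->
  exists B, [/\ B `<=` A, unbounded B & exists z l, [/\ nrm z <= 1, cvg_along B (f ^~ z) l &
    forall x, nrm x <= 1 -> exists N, forall n, (N <= n)%N -> B n -> h x - f n x <= h z - l + e]].
Proof.
move=> fB hC e0 Au.
pose S := [set a | exists x, nrm x <= 1 /\ forall N, exists n, [/\ (N <= n)%N, A n & a < h x - f n x]].
have fb n x : nrm x <= 1 -> `|f n x| <= 1 by apply: le_trans; exact: dual_ball_norm.
have Ssup : has_sup S.
  split.
    exists (h 0 - 1); exists 0; rewrite (seminorm0 _ nrmS) ler01; split=> // N.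
    have [n [Nn An]] := Au N; exists n; split=> //.
    rewrite (functional0 _ (fB n).1); lra.
  exists (C + 1) => a [x [x1 /(_ 0%N)[n [_ _ alt]]]].
  have := hC _ x1; have := fb n _ x1; rewrite !ler_norml => /andP[? ?] /andP[? ?]; lra.
have e20 : 0 < e / 2 by rewrite divr_gt0.
have [a [z [z1 za]] Sa] := sup_adherent e20 Ssup.
pose A1 := [set n | A n /\ a < h z - f n z].
have A1u : unbounded A1 by move=> N; have [n [? ? ?]] := za N; exists n.
have [B [l [BA1 Bu Bl]]] := bounded_cvg_along A1 (f ^~ z) 1 A1u (fun n => fb n z z1).
exists B; split=> //; first by move=> n /BA1[].
exists z, l; split=> // x x1.
have la : l <= h z - a.
  apply/ler_addgt0Pl => d d0; have [N HN] := Bl d d0; have [n [Nn Bn]] := Bu N.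
  have := HN n Nn Bn; have [_] := BA1 n Bn; rewrite ler_norml => ? /andP[? ?]; lra.
apply: contrapT => /forallNP H.
have : S (sup S + e / 2).
  exists x; split=> // N; have /existsNP[n /not_implyP[Nn /not_implyP[Bn /negP]]] := H N.
  by rewrite -ltNge => Hn; exists n; split=> //; [exact: (BA1 n Bn).1|lra].
move=> /(sup_upper_bound Ssup); lra.
Qed.

End Dichotomy.

(** * Subsequences that attain their oscillation *)
Lemma geometric_small (R : realType) (r e : R) N : 0 <= r < 1 -> 0 < e -> exists m, (N <= m)%N /\ r ^+ m <= e.
Proof.
move=> /andP[r0 r1] e0; have : r ^+ n @[n --> \oo] --> 0 by apply: cvg_expr; rewrite ger0_norm.
move=> /cvgrPdist_le/(_ e e0)[M _ HM]; exists (maxn N M); split; first exact: leq_maxl.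
have := HM (maxn N M) (leq_maxr _ _); rewrite sub0r normrN ger0_norm//.
exact: exprn_ge0.
Qed.

Section James.
Context {R : realType} {V : lmodType R} {nrm : V -> R} (nrmS : seminorm nrm).
Implicit Types (f : nat -> V -> R) (g h : V -> R).
Local Notation dual_ball := (dual_ball (nrm := nrm)).

Definition rat_comb f (s : seq (rat * nat)) x : R := \sum_(p <- s) ratr p.1 * f p.2 x.

Definition approximable f h := forall e, 0 < e -> exists s, forall x, nrm x <= 1 ->
  `|h x - rat_comb f s x| <= e.

Lemma rat_comb_bounded f s x : (forall n, dual_ball (f n)) -> nrm x <= 1 ->
  `|rat_comb f s x| <= \sum_(p <- s) `|ratr p.1|.
Proof.
move=> fB x1; apply: le_trans (ler_norm_sum _ _ _) _; apply: ler_sum => p _.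
rewrite normrM -[leRHS]mulr1 ler_wpM2l// (le_trans _ x1)//; exact: dual_ball_norm.
Qed.

Lemma approximable_bounded f h : (forall n, dual_ball (f n)) -> approximable f h ->
  exists C, 0 < C /\ forall x, nrm x <= 1 -> `|h x| <= C.
Proof.
move=> fB /(_ 1 ltr01)[s hs]; exists (1 + \sum_(p <- s) `|ratr p.1|); split.
  by rewrite ltr_pwDl// sumr_ge0.
move=> x x1; rewrite -(subrK (rat_comb f s x) (h x)).
by apply: le_trans (ler_normD _ _) _; rewrite lerD ?hs ?rat_comb_bounded.
Qed.

Lemma approximableD f g h : approximable f g -> approximable f h ->
  approximable f (fun x => g x + h x).
Proof.
move=> gA hA e e0; have e20 : 0 < e / 2 by rewrite divr_gt0.
have [s sP] := gA _ e20; have [t tP] := hA _ e20; exists (s ++ t) => x x1.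
rewrite /rat_comb big_cat/= opprD addrACA.
apply: le_trans (ler_normD _ _) _.
have := sP x x1; have := tP x x1; rewrite /rat_comb; lra.
Qed.

Lemma approximableZ f a h : (forall n, dual_ball (f n)) -> approximable f h ->
  approximable f (fun x => a * h x).
Proof.
move=> fB hA e e0; have [C [C0 hC]] := approximable_bounded f h fB hA.
have d0 : 0 < Num.min 1 (e / (2 * C)) by rewrite lt_min ltr01 divr_gt0 ?mulr_gt0.
set d := Num.min _ _ in d0.
have [q] : exists q, ratr q \in `]a - d, a + d[%R by apply: rat_in_itvoo; lra.
rewrite in_itv/= => /andP[aq qa].
have b0 : 0 < e / (2 * (`|a| + 1)) by rewrite divr_gt0 ?mulr_gt0// ltr_wpDl.
have [s sP] := hA _ b0; exists [seq (q * p.1, p.2) | p <- s] => x x1.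
have -> : rat_comb f [seq (q * p.1, p.2) | p <- s] x = ratr q * rat_comb f s x.
  rewrite /rat_comb big_map mulr_sumr; apply: eq_bigr => p _.
  by rewrite /= rmorphM/= mulrA.
have -> : a * h x - ratr q * rat_comb f s x =
  (a - ratr q) * h x + ratr q * (h x - rat_comb f s x) by ring.
apply: le_trans (ler_normD _ _) _; rewrite [`|_ * h x|]normrM [`|ratr q * _|]normrM.
have dd : `|a - ratr q| <= d by rewrite ler_norml; apply/andP; split; lra.
have d1 : d <= 1 by rewrite ge_min lexx.
have d2 : d <= e / (2 * C) by rewrite ge_min lexx orbT.
have q1 : `|ratr q| <= `|a| + 1.
  rewrite -(subrK a (ratr q)) addrC (le_trans (ler_normD _ _))// lerD2l distrC.
  exact: le_trans d1.
have -> : e = e / (2 * C) * C + (`|a| + 1) * (e / (2 * (`|a| + 1))).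
  field; rewrite !gt_eqF//; first by rewrite ltr_wpDl.
apply: lerD.
  by apply: ler_pM => //; [exact: le_trans d2|exact: hC].
by apply: ler_pM; rewrite ?normr_ge0 ?q1 ?sP.
Qed.

Lemma approximable_seq f n : approximable f (f n).
Proof.
move=> e e0; exists [:: (1, n)] => x _.
by rewrite /rat_comb big_seq1 /= rmorph1 mul1r subrr normr0 ltW.
Qed.

Lemma hull_approximable f g : (forall n, dual_ball (f n)) -> hull (range f) g -> approximable f g.
Proof.
move=> fB; apply=> [t g1 g2 _ h1 h2|_ [n _ <-]]; last exact: approximable_seq.
by apply: approximableD; exact: approximableZ.
Qed.

(** For [h] in the closed span of the [f_n], the quantity [h x - liminf f_n x] has
    the same supremum over the whole unit ball as over the points [z] at which [f]
    converges.  A functional [w] between the lower and upper limits of [f] takes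
    the value [lim f_n z] at these points, so that the supremum of [h - w] over
    the ball does not depend on [w]. *)
Definition attains_oscillation f := forall h, approximable f h -> forall e, 0 < e ->
  exists z l, [/\ nrm z <= 1, cvg_along setT (f ^~ z) l &
    forall x, nrm x <= 1 -> exists N, forall n, (N <= n)%N -> h x - f n x <= h z - l + e].

(** Rational combinations of the [f_n] are countably many, so that a diagonal
    subsequence deals with all of them, with all precisions [1 / (m + 1)]. *)
Lemma attains_oscillation_subseq f A : (forall n, dual_ball (f n)) -> unbounded A ->
  exists s, [/\ strictly_increasing s, forall n, A (s n) & attains_oscillation (f \o s)].
Proof.
move=> fB Au.
pose Q (c : seq (rat * nat)) (m : nat) (B : set nat) :=
  exists z l, [/\ nrm z <= 1, cvg_along B (f ^~ z) l &
    forall x, nrm x <= 1 -> exists N, forall n, (N <= n)%N -> B n ->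
      rat_comb f c x - f n x <= rat_comb f c z - l + m.+1%:R^-1].
pose P (j : nat) B := if @unpickle (seq (rat * nat) * nat)%type j is Some (c, m) then Q c m B else True.
have [||//|s [sS sA sP]] := diagonal P A.
- move=> j B Bu _; rewrite /P; case: (unpickle j) => [[c m]|]; last by exists B; split.
  have m0 : 0 < m.+1%:R^-1 :> R by rewrite invr_gt0.
  exact: (almost_optimal_point nrmS f (rat_comb f c) _ B _ fB (fun x => rat_comb_bounded f c x fB) m0 Bu).
- move=> j B C [N CB]; rewrite /P; case: (unpickle j) => [[c m]|//] [z [l [z1 zl H]]].
  exists z, l; split=> //; first by apply: cvg_along_sub zl; exists N.
  move=> x x1; have [M HM] := H x x1; exists (maxn N M) => n.
  by rewrite geq_max => /andP[Nn Mn] /(CB _ Nn); exact: HM.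
exists s; split=> // h hA e e0.
have e30 : 0 < e / 3 by rewrite divr_gt0.
have {}hA : approximable f h.
  move=> d d0; have [c cP] := hA d d0; exists [seq (p.1, s p.2) | p <- c] => x x1.
  by have := cP x x1; rewrite /rat_comb big_map.
have [c cP] := hA _ e30.
have [m mP] : exists m, m.+1%:R^-1 < e / 3.
  exists (Num.truncn (e / 3)^-1); rewrite -[ltRHS]invrK ltf_pV2 ?posrE ?invr_gt0//.
  by rewrite truncnS_gt.
have := sP (pickle (c, m)); rewrite /P pickleK => -[z [l [z1 zl H]]].
exists z, l; split=> //.
  move=> d d0; have [N HN] := zl d d0; exists N => n Nn _; apply: HN; last by exists n.
  exact: leq_trans (strictly_increasing_ge s n sS).
move=> x x1; have [N HN] := H x x1; exists N => n Nn.
have := HN (s n) (leq_trans Nn (strictly_increasing_ge s n sS)) ltac:(by exists n).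
have := cP x x1; have := cP z z1; move: mP; set b := _^-1.
rewrite /= !ler_norml => mP /andP[? ?] /andP[? ?] ?; lra.
Qed.

End James.

(** * Pointwise cluster functionals *)
Section JamesTheorem.
Context {R : realType} {V : lmodType R} {nrm : V -> R} (nrmS : seminorm nrm).
Implicit Types (f : nat -> V -> R) (g h w : V -> R).
Local Notation dual_ball := (dual_ball (nrm := nrm)).
Local Notation approximable := (approximable (nrm := nrm)).

(** An eventual lower bound of [f_n x] is a lower bound of [w x]; for linear
    functionals the same follows for upper bounds. *)
Definition tracks w f := functional w /\
  forall x a N, (forall n, (N <= n)%N -> a <= f n x) -> a <= w x.

Lemma exists_tracking f : (forall n, dual_ball (f n)) -> exists w, tracks w f.
Proof.
move=> fB; apply: (cluster_functional nrm) => n; first exact: (fB n).1.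
by move=> x; exact: dual_ball_norm.
Qed.

Lemma tracks_ub w f x a N : (forall n, functional (f n)) -> tracks w f ->
  (forall n, (N <= n)%N -> f n x <= a) -> w x <= a.
Proof.
move=> fl [wl wf] H; rewrite -lerN2 -(functionalN w x wl); apply: (wf _ _ N) => n Nn.
by rewrite functionalN// lerN2 H.
Qed.

Lemma tracks_dual_ball w f : (forall n, dual_ball (f n)) -> tracks w f -> dual_ball w.
Proof.
move=> fB wf; split; first exact: wf.1.
by move=> x; apply: (tracks_ub _ _ _ _ 0 _ wf) => n; [exact: (fB n).1|move=> _; exact: (fB n).2].
Qed.

Lemma tracks_cvg w f z l : (forall n, functional (f n)) -> tracks w f ->
  cvg_along setT (f ^~ z) l -> w z = l.
Proof.
move=> fl wf fzl; apply/eqP; rewrite eq_le; apply/andP; split; apply/ler_addgt0Pl => e e0;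
  have [N HN] := fzl e e0.
  apply: (tracks_ub _ _ _ _ N fl wf) => n Nn.
  by have := HN n Nn I; rewrite ler_norml => /andP[_]; lra.
rewrite -lerBlDl; apply: (wf.2 _ _ N) => n Nn.
by have := HN n Nn I; rewrite ler_norml => /andP[+ _]; lra.
Qed.

Definition tail_hull f i := hull (f @` [set n | (i <= n)%N]).

Lemma tail_hull_dual_ball f i g : (forall n, dual_ball (f n)) -> tail_hull f i g -> dual_ball g.
Proof. by move=> fB; apply: (hull_dual_ball _ _ g) => _ [n _ <-]; exact: fB. Qed.

Lemma tail_hull_mono f i j : (i <= j)%N -> tail_hull f j `<=` tail_hull f i.
Proof.
move=> ij; apply: hull_mono => _ [n /= jn <-]; exists n => //=; exact: leq_trans jn.
Qed.

Lemma tail_hull_approximable f i g : (forall n, dual_ball (f n)) -> tail_hull f i g -> approximable f g.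
Proof.
move=> fB gH; apply: (hull_approximable nrmS) => //; apply: hull_mono gH => _ [n _ <-]; by exists n.
Qed.

(** An eventual lower bound of [f_n x] is inherited by convex combinations of the
    tails of [f]. *)
Lemma tracks_tail_hull w f (g : nat -> V -> R) :
  (forall n, tail_hull f n (g n)) -> tracks w g -> tracks w f.
Proof.
move=> gH [wl wg]; split=> // x a N H; apply: (wg _ _ N) => n Nn.
apply: (gH n [set g | a <= g x]) => [t g1 g2 /andP[t0 t1] /= h1 h2|_ [m /= nm <-]]; last first.
  by apply: H; exact: leq_trans nm.
have -> : a = t * a + (1 - t) * a by ring.
by rewrite lerD// ler_wpM2l// subr_ge0.
Qed.

Definition oscillation_values f h : set R :=
  [set a | exists z l, [/\ nrm z <= 1, cvg_along setT (f ^~ z) l & a = h z - l]].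

(** By the two lemmas [tracks_le_oscillation] and [oscillation_le] below, this is
    the supremum of [h - w] over the unit ball, for every [w] that tracks [f], as
    soon as [f] attains its oscillation. *)
Definition oscillation f h := sup (oscillation_values f h).

Section Oscillation.
Context {f : nat -> V -> R} (fB : forall n, dual_ball (f n)).
Let fl n : functional (f n) := (fB n).1.

Lemma oscillation_has_sup h C : (forall x, nrm x <= 1 -> h x <= C) -> has_sup (oscillation_values f h).
Proof.
move=> hC; split.
  exists (h 0 - 0), 0, 0; split=> //; first by rewrite (seminorm0 _ nrmS).
  by move=> e e0; exists 0%N => n _ _; rewrite functional0// subrr normr0 ltW.
exists (C + 1) => _ [z [l [z1 zl ->]]].
have [w wf] := exists_tracking f fB; have <- := tracks_cvg w f z l fl wf zl.
have := dual_ball_norm nrmS _ z (tracks_dual_ball w f fB wf).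
have := hC z z1; rewrite ler_norml => ? /andP[? ?]; lra.
Qed.

Lemma le_oscillation h z l : approximable f h -> nrm z <= 1 -> cvg_along setT (f ^~ z) l ->
  h z - l <= oscillation f h.
Proof.
move=> hA z1 zl; have [C [_ hC]] := approximable_bounded nrmS f h fB hA.
apply: (sup_upper_bound (oscillation_has_sup h C _)); last by exists z, l.
by move=> x /hC; rewrite ler_norml => /andP[].
Qed.

Lemma oscillation_ge0 h : approximable f h -> functional h -> 0 <= oscillation f h.
Proof.
move=> hA hl; have := le_oscillation h 0 0 hA; rewrite (functional0 h hl) subr0; apply.
  by rewrite (seminorm0 _ nrmS).
by move=> e e0; exists 0%N => n _ _; rewrite functional0// subrr normr0 ltW.
Qed.

Lemma oscillation_le w h c : tracks w f -> (forall x, nrm x <= 1 -> h x - w x <= c) -> oscillation f h <= c.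
Proof.
move=> wf hc; apply: ge_sup => [|_ [z [l [z1 zl ->]]]].
  exists (h 0 - 0), 0, 0; split=> //; first by rewrite (seminorm0 _ nrmS).
  by move=> e e0; exists 0%N => n _ _; rewrite functional0// subrr normr0 ltW.
by rewrite -(tracks_cvg w f z l)// hc.
Qed.

Lemma eventually_le_oscillation h x e : attains_oscillation (nrm := nrm) f -> approximable f h ->
  nrm x <= 1 -> 0 < e -> exists N, forall n, (N <= n)%N -> h x - f n x <= oscillation f h + e.
Proof.
move=> fA hA x1 e0; have [z [l [z1 zl H]]] := fA h hA e e0.
have [N HN] := H x x1; exists N => n Nn; apply: le_trans (HN n Nn) _.
by rewrite lerD2r; exact: le_oscillation.
Qed.

Lemma tracks_le_oscillation w h x : attains_oscillation (nrm := nrm) f -> approximable f h ->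
  tracks w f -> nrm x <= 1 -> h x - w x <= oscillation f h.
Proof.
move=> fA hA wf x1; apply/ler_addgt0Pl => e e0.
have [N HN] := eventually_le_oscillation h x e fA hA x1 e0.
suff : h x - oscillation f h - e <= w x by lra.
by apply: (wf.2 _ _ N) => n Nn; have := HN n Nn; lra.
Qed.

End Oscillation.

End JamesTheorem.

(** * James's construction of a functional that does not attain its norm *)
Section JamesConstruction.
Context {R : realType} {V : lmodType R} {nrm : V -> R} (nrmS : seminorm nrm).
Local Notation dual_ball := (dual_ball (nrm := nrm)).
Local Notation approximable := (approximable (nrm := nrm)).
Context {f : nat -> V -> R} {theta : R} (fB : forall n, dual_ball (f n)).
Context (fA : attains_oscillation (nrm := nrm) f) (theta0 : 0 < theta).
Context (fgap : forall g, hull (range f) g ->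
  exists x, nrm x <= 1 /\ forall N, exists n, (N <= n)%N /\ f n x < g x - theta).
Implicit Types (g h w : V -> R).
Local Notation osc := (oscillation (nrm := nrm) f).

(* The weight T n - T n.+1 is given to the term of index n, and T n.+1 is left for
   all the later ones together.  It is at most theta / 8 * T n, too small to hide
   a deficit of order theta * T n. *)
Let r := theta / (8 + theta).
Let r0 : 0 < r. Proof. by rewrite divr_gt0// addr_gt0. Qed.
Let r1 : r < 1. Proof. rewrite ltr_pdivrMr ?addr_gt0//; lra. Qed.
Let rtheta : 8 * r <= theta.
Proof.
rewrite /r mulrA ler_pdivrMr ?addr_gt0//; have : 0 <= theta * theta by rewrite mulr_ge0 ?ltW.
lra.
Qed.
Let T n := r ^+ n.
Let T0 n : 0 < T n. Proof. by rewrite exprn_gt0. Qed.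
Let TS n : T n.+1 = r * T n. Proof. by rewrite /T exprS. Qed.
Let TSle n : T n.+1 <= T n. Proof. by rewrite TS ler_piMl// ltW. Qed.
Let T1 n : T n <= 1. Proof. by rewrite exprn_ile1// ltW. Qed.

(** With [h] the sum of the terms chosen so far, all the remaining weight [T i] is
    put on a single element of the [i]-th tail hull. *)
Definition james_optimum i h := inf [set osc (fun x => h x + T i * g x) | g in tail_hull f i].

(* The errors made at the successive steps add up, in the lemma on partial sums of
   the last proof, to at most theta / 4 * T n. *)
Let tol n := theta / 4 * T n.+1 * T n.
Let tol0 n : 0 < tol n. Proof. rewrite /tol; apply: mulr_gt0 => //; apply: mulr_gt0 => //; exact: divr_gt0. Qed.

Lemma james_extend_approximable i h g : approximable f h -> tail_hull f i g ->
  approximable f (fun x => h x + T i * g x).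
Proof.
move=> hA gH; apply: approximableD => //; apply: (approximableZ nrmS) => //.
exact: (tail_hull_approximable nrmS _ i).
Qed.

Lemma functional_extend a h g : functional h -> functional g -> functional (fun x => h x + a * g x).
Proof. by move=> hl gl b x y; rewrite hl gl; ring. Qed.

Lemma james_optimum_le i h g : functional h -> approximable f h -> tail_hull f i g ->
  james_optimum i h <= osc (fun x => h x + T i * g x).
Proof.
move=> hl hA gH; apply: ge_inf; last by exists g.
exists 0 => _ [g' g'H <-]; apply: (oscillation_ge0 nrmS fB); first exact: james_extend_approximable.
by apply: functional_extend => //; have [] := tail_hull_dual_ball _ _ _ fB g'H.
Qed.

Lemma le_james_optimum i h c : (forall g, tail_hull f i g -> c <= osc (fun x => h x + T i * g x)) ->
  c <= james_optimum i h.
Proof.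
move=> H; apply: lb_le_inf; last by move=> _ [g gH <-]; exact: H.
exists (osc (fun x => h x + T i * f i x)); exists (f i) => //.
by apply: sub_hull; exists i => /=.
Qed.

Let near_optimal (ih : nat * (V -> R)) : exists g, functional ih.2 -> approximable f ih.2 ->
  tail_hull f ih.1 g /\ osc (fun x => ih.2 x + T ih.1 * g x) <= james_optimum ih.1 ih.2 + tol ih.1.
Proof.
case: ih => i h /=; have [hl|] := pselect (functional h); last by exists (f 0%N).
have [hA|] := pselect (approximable f h); last by exists (f 0%N).
have [|_ [g gH <-] gopt] := @inf_adherent R [set osc (fun x => h x + T i * g x) | g in tail_hull f i] _ (tol0 i).
  split; first by exists (osc (fun x => h x + T i * f i x)); exists (f i) => //; apply: sub_hull; exists i => /=.
  exists 0 => _ [g' g'H <-]; apply: (oscillation_ge0 nrmS fB); first exact: james_extend_approximable.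
  by apply: functional_extend => //; have [] := tail_hull_dual_ball _ _ _ fB g'H.
by exists g => _ _; split=> //; exact: ltW.
Qed.

Let pick := projT1 (choice near_optimal).
Let pickP := projT2 (choice near_optimal).
Let H := fix H n : V -> R := if n is m.+1 then fun x => H m x + (T m - T m.+1) * pick (m, H m) x
  else fun=> 0.
Let g n := pick (n, H n).

Let HS n x : H n.+1 x = H n x + (T n - T n.+1) * g n x. Proof. by []. Qed.

Let HP n : functional (H n) /\ approximable f (H n).
Proof.
elim: n => [|n [Hl HA]].
  split=> [a x y|e e0] /=; first by rewrite mulr0 addr0.
  by exists [::] => x _; rewrite /rat_comb big_nil subrr normr0 ltW.
have [gH _] := pickP (n, H n) Hl HA.
split=> /=; first by apply: functional_extend => //; have [] := tail_hull_dual_ball _ _ _ fB gH.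
apply: approximableD => //; apply: (approximableZ nrmS) => //.
exact: (tail_hull_approximable nrmS _ n).
Qed.

Let gH n : tail_hull f n (g n). Proof. by have [] := pickP (n, H n) (HP n).1 (HP n).2. Qed.
Let gB n : dual_ball (g n). Proof. exact: (tail_hull_dual_ball _ _ _ fB (gH n)). Qed.
Let gopt n : osc (fun x => H n x + T n * g n x) <= james_optimum n (H n) + tol n.
Proof. by have [] := pickP (n, H n) (HP n).1 (HP n).2. Qed.

Let Hdiff m n x : (n <= m)%N -> `|H m x - H n x| <= (T n - T m) * nrm x.
Proof.
elim: m => [|m IH]; first by rewrite leqn0 => /eqP ->; rewrite !subrr normr0 mul0r.
rewrite leq_eqVlt => /predU1P[->|]; first by rewrite !subrr normr0 mul0r.
rewrite ltnS => /IH {}IH; rewrite HS.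
have -> : H m x + (T m - T m.+1) * g m x - H n x = (H m x - H n x) + (T m - T m.+1) * g m x by ring.
apply: le_trans (ler_normD _ _) _; have -> : T n - T m.+1 = (T n - T m) + (T m - T m.+1) by ring.
rewrite [leRHS]mulrDl lerD// normrM ger0_norm ?subr_ge0// ler_wpM2l ?subr_ge0//.
exact: dual_ball_norm.
Qed.

Let Hball n : dual_ball (H n).
Proof.
split; first exact: (HP n).1.
move=> x; have := Hdiff n 0 x (leq0n n); rewrite subr0 => /(le_trans (ler_norm _)) /le_trans; apply.
by rewrite ler_piMl ?(seminorm_ge0 _ _ nrmS)// /T expr0 gerBl ltW.
Qed.

Lemma tracks_dist S (F : nat -> V -> R) h n c x : (forall n, functional (F n)) -> tracks S F ->
  (forall m, (n <= m)%N -> `|F m x - h x| <= c) -> `|S x - h x| <= c.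
Proof.
move=> Fl SF Fc; rewrite ler_norml; apply/andP; split.
  rewrite lerBrDr; apply: (SF.2 _ _ n) => m nm.
  by have := Fc m nm; rewrite ler_norml => /andP[+ _]; lra.
rewrite lerBlDr; apply: (tracks_ub S F _ _ n Fl SF) => m nm.
by have := Fc m nm; rewrite ler_norml => /andP[_]; lra.
Qed.

(** Splitting the weight [T n] between [g n] and an element of the next tail hull
    gives again an element of the [n]-th tail hull. *)
Lemma james_optimum_step n : james_optimum n (H n) <= james_optimum n.+1 (H n.+1).
Proof.
apply: le_james_optimum => g' g'H.
have -> : (fun x => H n.+1 x + T n.+1 * g' x) =
    (fun x => H n x + T n * ((1 - r) * g n x + (1 - (1 - r)) * g' x)).
  by apply/funext => x; rewrite HS TS; ring.
apply: james_optimum_le; [exact: (HP n).1|exact: (HP n).2|].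
apply: hull_convex; first by rewrite subr_ge0 gerBl !ltW.
  exact: gH.
exact: tail_hull_mono (leqnSn n) _ g'H.
Qed.

Lemma james_optimum_homo m n : (m <= n)%N -> james_optimum m (H m) <= james_optimum n (H n).
Proof.
elim: n => [|n IH]; first by rewrite leqn0 => /eqP ->.
rewrite leq_eqVlt => /predU1P[->//|/IH h]; exact: le_trans (james_optimum_step n).
Qed.

(** Here the gap hypothesis on convex combinations of the [f_n] is used. *)
Lemma theta_le_optimum : theta <= james_optimum 0 (H 0%N).
Proof.
apply: le_james_optimum => g' g'H.
have g'R : hull (range f) g' by apply: hull_mono g'H => _ [n _ <-]; exists n.
have [x [x1 Hx]] := fgap g' g'R.
have -> : (fun x => H 0%N x + T 0%N * g' x) = g'.
  by apply/funext => y; rewrite /= /T expr0 mul1r add0r.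
apply/ler_addgt0Pl => e e0.
have [N HN] := eventually_le_oscillation nrmS fB g' x e fA (tail_hull_approximable nrmS _ _ _ fB g'H) x1 e0.
have [n [Nn]] := Hx N; have := HN n Nn; lra.
Qed.

(** The functional is [S - w], normalised, where [S] is the sum of the series with
    partial sums [H n] and [w] is a cluster functional of [g].  Its norm [alpha]
    is at least each optimum, hence at least [theta].  By the near-optimal choice
    of the [g n], the partial sums [H n - (1 - T n) w] stay below [alpha] by about
    [alpha * T n]; at a point where [S - w] equals [alpha], the term of index [n]
    has to make up for this, since the later terms are too small.  This gives
    [g n x >= w x + theta / 4] for all [n], which a cluster functional [w] of [g]
    excludes. *)
Theorem james_functional : exists u, [/\ dual_ball u, forall x, nrm x <= 1 -> u x < 1 &
  forall e, 0 < e -> exists x, nrm x <= 1 /\ 1 - e < u x].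
Proof.
have [w wg] := exists_tracking nrmS g gB.
have [S SH] := exists_tracking nrmS H Hball.
have wf : tracks w f by exact: tracks_tail_hull wg.
have wB := tracks_dual_ball w g gB wg.
have SB := tracks_dual_ball S H Hball SH.
have Sdist n x : nrm x <= 1 -> `|S x - H n x| <= T n.
  move=> x1; apply: (tracks_dist S H _ n _ _ (fun n => (HP n).1) SH) => m nm.
  apply: le_trans (Hdiff m n x nm) _.
  have Tmn : T m <= T n.
    by apply: (@homo_leq _ T (fun a b => b <= a)) nm => // a b c /[swap]; exact: le_trans.
  have : (T n - T m) * nrm x <= T n - T m by rewrite ler_piMr// subr_ge0.
  have := T0 m; lra.
pose D := [set S x - w x | x in [set x | nrm x <= 1]].
have Dsup : has_sup D.
  split; first by exists (S 0 - w 0); exists 0 => //=; rewrite (seminorm0 _ nrmS).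
  exists 2 => _ [x /= x1 <-].
  have := dual_ball_norm nrmS _ x wB; have := dual_ball_norm nrmS _ x SB.
  rewrite !ler_norml => /andP[? ?] /andP[? ?]; lra.
set alpha := sup D.
have Sw x : nrm x <= 1 -> S x - w x <= alpha by move=> x1; apply: (sup_upper_bound Dsup); exists x.
have opt_alpha i : james_optimum i (H i) <= alpha.
  apply/ler_addgt0Pl => e e0.
  have rr : 0 <= r < 1 by rewrite r1 ltW.
  have e20 : 0 < e / 2 by rewrite divr_gt0.
  have [m [im Tm]] := geometric_small R r (e / 2) i rr e20.
  apply: le_trans (james_optimum_homo i m im) _.
  apply: le_trans (james_optimum_le m _ _ (HP m).1 (HP m).2 (gH m)) _.
  apply: (oscillation_le nrmS fB w _ _ wf) => x x1.
  have := Sdist m x x1; have := Sw x x1; have := dual_ball_norm nrmS _ x (gB m).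
  rewrite !ler_norml => /andP[_ gx] ? /andP[? ?].
  have : T m * g m x <= T m by rewrite ler_piMr ?(le_trans gx)// ltW.
  by rewrite -/(T m) in Tm; lra.
have alpha_theta : theta <= alpha := le_trans theta_le_optimum (opt_alpha 0%N).
(* [H n.+1 - (1 - T n.+1) w] is a convex combination of the nearly optimal
   functional of step n and of [H n - (1 - T n) w], with coefficients 1 - r and r. *)
have partial n x : nrm x <= 1 ->
    H n x - (1 - T n) * w x <= alpha * (1 - T n) + theta / 4 * T n * (1 - T n).
  move=> x1; elim: n => [|n IH]; first by rewrite /T expr0 /=; lra.
  have opt : H n x + T n * g n x - w x <= alpha + tol n.
    apply: (@le_trans _ _ (osc (fun x => H n x + T n * g n x))).
      apply: (tracks_le_oscillation nrmS fB w (fun x => H n x + T n * g n x)) => //.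
      exact: (james_extend_approximable n _ _ (HP n).2 (gH n)).
    by apply: le_trans (gopt n) _; rewrite lerD2r.
  have -> : H n.+1 x - (1 - T n.+1) * w x =
      (1 - r) * (H n x + T n * g n x - w x) + r * (H n x - (1 - T n) * w x).
    by rewrite HS TS; ring.
  have h1 := ler_wpM2l (_ : 0 <= 1 - r) opt; have h2 := ler_wpM2l (ltW r0) IH.
  apply: le_trans (lerD (h1 _) h2) _; first by rewrite subr_ge0 ltW.
  rewrite /tol TS le_eqVlt; apply/orP; left; apply/eqP; ring.
have notatt x : nrm x <= 1 -> S x - w x < alpha.
  move=> x1; rewrite lt_neqAle Sw// andbT; apply/negP => /eqP Sx.
  have gw n : w x + theta / 4 <= g n x.
    have h1 := partial n x x1; have h2 := Sdist n.+1 x x1.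
    have h3 := dual_ball_norm nrmS _ x wB.
    have : (theta / 4) * (T n - T n.+1) <= (T n - T n.+1) * (g n x - w x).
      have -> : (T n - T n.+1) * (g n x - w x) = (H n.+1 x - (1 - T n.+1) * w x) - (H n x - (1 - T n) * w x).
        by rewrite HS; ring.
      have t1 : theta * T n <= alpha * T n by rewrite ler_pM2r.
      have t2 : 8 * T n.+1 <= theta * T n by rewrite TS mulrA ler_pM2r.
      have t3 : - T n.+1 <= T n.+1 * w x.
        rewrite -mulrN1 ler_pM2l//; move: h3; rewrite ler_norml => /andP[+ _]; lra.
      have t4 : 0 <= theta * T n * T n by rewrite !mulr_ge0// ltW.
      have t5 : 0 <= theta * T n.+1 by rewrite mulr_ge0// ltW.
      have t6 : 0 < theta * T n by rewrite mulr_gt0.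
      move: h2; rewrite ler_norml => /andP[_ h2]; lra.
    rewrite mulrC ler_pM2l ?subr_gt0; first by rewrite lerBrDl.
    by rewrite TS -subr_gt0 -{1}(mul1r (T n)) -mulrBl mulr_gt0// subr_gt0.
  have := wg.2 x (w x + theta / 4) 0%N (fun n _ => gw n).
  have : 0 < theta / 4 by rewrite divr_gt0.
  lra.
have a0 : 0 < alpha by exact: lt_le_trans alpha_theta.
exists (fun x => alpha^-1 * S x + (- alpha^-1) * w x); split.
- split; first by apply: functional_comb; [exact: SB.1|exact: wB.1].
  move=> x; rewrite mulNr -mulrBr ler_pdivrMl//.
  have Sx := dual_ball_norm nrmS _ x SB; have wx := dual_ball_norm nrmS _ x wB.
  have [x0|x0] := eqVneq (nrm x) 0.
    by move: Sx wx; rewrite x0 !normr_le0 => /eqP -> /eqP ->; rewrite subrr mulr0.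
  have nx0 : 0 < nrm x by rewrite lt_neqAle eq_sym x0 (seminorm_ge0 _ _ nrmS).
  have := Sw ((nrm x)^-1 *: x); rewrite nrmS.2 ger0_norm ?invr_ge0 ?(ltW nx0)// mulVf//.
  rewrite (functionalZ S _ _ SB.1) (functionalZ w _ _ wB.1) -mulrBr ler_pdivrMl// mulrC; exact.
- by move=> x x1; rewrite mulNr -mulrBr -ltr_pdivlMl ?invr_gt0// invrK mulr1 notatt.
- move=> e e0; have ea : 0 < alpha * e by rewrite mulr_gt0.
  have [_ [x x1 <-] Hx] := sup_adherent ea Dsup; exists x; split=> //.
  by rewrite mulNr -mulrBr -ltr_pdivrMl ?invr_gt0// invrK mulrBr mulr1.
Qed.

End JamesConstruction.

(** * Compactness of the dual ball and weak-star null sequences *)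
Section FunctionalDichotomy.
Context {R : realType} {V : lmodType R} {nrm : V -> R} (nrmS : seminorm nrm).
Local Notation dual_ball := (dual_ball (nrm := nrm)).
Implicit Types (f : nat -> V -> R).

Definition nonattaining (u : V -> R) := [/\ dual_ball u, forall x, nrm x <= 1 -> u x < 1 &
  forall e, 0 < e -> exists x, nrm x <= 1 /\ 1 - e < u x].

Definition dual_ball_compact := forall f, (forall n, dual_ball (f n)) ->
  exists s w, [/\ strictly_increasing s, functional w &
    forall x e, 0 < e -> exists N, forall n, (N <= n)%N -> `|f (s n) x - w x| <= e].

(** If all subsequences of [f] have, for each [theta], a further subsequence [B]
    and a functional [g] with [g x - theta <= f_n x] eventually along [B] for all
    [x] in the ball, then applying this to [x] and [- x] along a diagonal
    subsequence shows that [f_n x] is a Cauchy sequence.  Otherwise some sequence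
    has a subsequence with the gap that James's construction requires, and the gap
    is kept by further subsequences. *)
Lemma nonattaining_or_compact : (exists u, nonattaining u) \/ dual_ball_compact.
Proof.
have [[f [theta [A [fB theta0 Au Hgap]]]]|Hno] := pselect (exists f theta A,
  [/\ forall n, dual_ball (f n), 0 < theta, unbounded A & forall B, B `<=` A -> unbounded B ->
    forall g, dual_ball g -> exists x, nrm x <= 1 /\ forall N, exists n,
      [/\ (N <= n)%N, B n & f n x < g x - theta]]); [left|right].
  have [s [sS sA fsA]] := attains_oscillation_subseq nrmS f A fB Au.
  have fsB n : dual_ball ((f \o s) n) by exact: fB.
  apply: (james_functional nrmS fsB fsA theta0) => g gH.
  have [|||x [x1 Hx]] := Hgap (range s) _ _ g.
  - by move=> _ [n _ <-].
  - by move=> N; exists (s N); split; [exact: strictly_increasing_ge|exists N].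
  - by apply: (hull_dual_ball _ _ g gH) => _ [n _ <-].
  exists x; split=> // N; have [m [+ [n _ sn]]] := Hx (s N).
  by rewrite -sn => /(strictly_increasing_le _ _ _ sS) Nn fn; exists n.
move=> f fB.
pose P (j : nat) (B : set nat) := exists g, dual_ball g /\ forall x, nrm x <= 1 ->
  exists N, forall n, (N <= n)%N -> B n -> g x - j.+1%:R^-1 <= f n x.
have [||//|s [sS _ sP]] := diagonal P setT.
- move=> j A Au _; apply: contrapT => H; apply: Hno; exists f, j.+1%:R^-1, A.
  split=> //; first by rewrite invr_gt0.
  move=> B BA Bu g gB; apply: contrapT => H'; apply: H; exists B; split=> //.
  exists g; split=> // x x1; apply: contrapT => /forallNP H''; apply: H'.
  exists x; split=> // N; have /existsNP[n /not_implyP[Nn /not_implyP[Bn /negP]]] := H'' N.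
  by rewrite -ltNge => ?; exists n.
- move=> j A B [N BA] [g [gB H]]; exists g; split=> // x x1.
  have [M HM] := H x x1; exists (maxn N M) => n.
  by rewrite geq_max => /andP[Nn Mn] /(BA _ Nn); exact: HM.
- by move=> N; exists N.
have fsl n : functional ((f \o s) n) by have [] := fB (s n).
have [w wf] : exists w, tracks w (f \o s) by apply: (exists_tracking nrmS) => n; exact: fB.
exists s, w; split=> //; first exact: wf.1.
move=> x e e0; pose c := nrm x + 1.
have c0 : 0 < c by rewrite ltr_wpDl// (seminorm_ge0 _ _ nrmS).
have [j jP] : exists j, j.+1%:R^-1 < e / (2 * c).
  have ec : 0 < e / (2 * c) by rewrite divr_gt0// mulr_gt0.
  exists (Num.truncn (e / (2 * c))^-1); rewrite -[ltRHS]invrK ltf_pV2 ?posrE ?invr_gt0//.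
  by rewrite truncnS_gt.
have [g [gB gP]] := sP j.
have near y : nrm y <= c -> exists N, forall n, (N <= n)%N -> g y - e / 2 <= f (s n) y.
  move=> yc; have [|N HN] := gP (c^-1 *: y).
    by rewrite nrmS.2 ger0_norm ?invr_ge0 ?(ltW c0)// ler_pdivrMl// mulr1.
  exists N => n Nn; have := HN (s n) (leq_trans Nn (strictly_increasing_ge s n sS)) ltac:(by exists n).
  rewrite (functionalZ g _ _ gB.1) (functionalZ (f (s n)) _ _ (fB (s n)).1) => h.
  have : c^-1 * g y - e / (2 * c) <= c^-1 * f (s n) y.
    by apply: le_trans h; rewrite lerD2l lerN2 ltW.
  have -> : c^-1 * g y - e / (2 * c) = c^-1 * (g y - e / 2) by field; rewrite gt_eqF.
  by rewrite ler_pM2l ?invr_gt0.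
have [|N1 HN1] := near x; first by rewrite lerDl.
have [|N2 HN2] := near (- x); first by rewrite (seminormN _ _ nrmS) lerDl.
have fg n : (maxn N1 N2 <= n)%N -> `|f (s n) x - g x| <= e / 2.
  rewrite geq_max => /andP[/HN1 + /HN2].
  rewrite (functionalN g _ gB.1) (functionalN (f (s n)) _ (fB (s n)).1) ler_norml.
  by move=> ? ?; apply/andP; split; lra.
have wg : `|w x - g x| <= e / 2.
  by apply: (tracks_dist w (f \o s) g (maxn N1 N2)) => // n Nn; exact: fg.
exists (maxn N1 N2) => n Nn; move: (fg n Nn) wg; rewrite !ler_norml.
by move=> /andP[? ?] /andP[? ?]; apply/andP; split; lra.
Qed.

Definition infinite_dimensional := ~ exists (n : nat) (v : nat -> V), forall x, exists c : nat -> R,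
  x = \sum_(i < n) c i *: v i.

Definition kills (us : seq (V -> R)) x := foldr (fun u P => u x = 0 /\ P) True us.

Lemma finite_codimension us : foldr (fun u P => functional u /\ P) True us ->
  exists (n : nat) (v : nat -> V), forall x, exists c : nat -> R, kills us (x - \sum_(i < n) c i *: v i).
Proof.
elim: us => [|u us IH] /=; first by exists 0%N, (fun=> 0) => x; exists (fun=> 0).
move=> [ul usl]; have [n [v vP]] := IH usl.
have kcomb a x y : kills us x -> kills us y -> kills us (a *: x + y).
  elim: (us) usl => //= t ts IHs [tl tsl] [xt xts] [yt yts]; split; last exact: IHs.
  by rewrite tl xt yt mulr0 addr0.
have [[y [yk uy]]|Hno] := pselect (exists y, kills us y /\ u y = 1); last first.
  exists n, v => x; have [c cx] := vP x; exists c; split=> //.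
  apply: contrapT => /eqP h; apply: Hno.
  exists ((u (x - \sum_(i < n) c i *: v i))^-1 *: (x - \sum_(i < n) c i *: v i)).
  split; last by rewrite functionalZ// mulVf.
  by rewrite -[X in kills us X]addr0; apply: (kcomb) => //;
    have := kcomb (-1) _ _ cx cx; rewrite scaleN1r addNr.
exists n.+1, (fun i => if i == n then y else v i) => x; have [c cx] := vP x.
set z := x - _ in cx; exists (fun i => if i == n then u z else c i).
have -> : x - \sum_(i < n.+1) (if i == n :> nat then u z else c i) *: (if i == n :> nat then y else v i) =
   (- u z) *: y + z.
  rewrite big_ord_recr/= eqxx opprD addrA scaleNr [RHS]addrC; congr (_ - _ - _).
  by apply: eq_bigr => i _; rewrite ltn_eqF.
split; last exact: kcomb.
by rewrite ul uy mulr1 addNr.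
Qed.

Lemma common_kernel us : infinite_dimensional -> foldr (fun u P => functional u /\ P) True us ->
  exists x, x != 0 /\ kills us x.
Proof.
move=> Vinf usl; apply: contrapT => H; apply: Vinf.
have [n [v vP]] := finite_codimension us usl; exists n, v => x; have [c cx] := vP x; exists c.
apply/eqP; rewrite -subr_eq0; apply/negP => /negP h; apply: H.
by exists (x - \sum_(i < n) c i *: v i).
Qed.

(** Choose [z n] of norm one in the common kernel of the functionals chosen before,
    and [u n] norming it.  Then [u n] and [u i], for [i < n], are at distance at
    least one, as [z n] shows. *)
Lemma separated_functionals : (forall x, nrm x = 0 -> x = 0) -> infinite_dimensional ->
  exists (u : nat -> V -> R) (z : nat -> V), forall n,
    [/\ dual_ball (u n), nrm (z n) = 1, u n (z n) = 1 & forall i, (i < n)%N -> u i (z n) = 0].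
Proof.
move=> nrm0 Vinf.
have ex (us : seq (V -> R)) : exists uz : (V -> R) * V,
    foldr (fun u P => functional u /\ P) True us ->
    [/\ dual_ball uz.1, nrm uz.2 = 1, uz.1 uz.2 = 1 & kills us uz.2].
  have [usl|] := pselect (foldr (fun u P => functional u /\ P) True us); last by exists (fun=> 0, 0).
  have [x [x0 xk]] := common_kernel us Vinf usl.
  have nx0 : 0 < nrm x.
    rewrite lt_neqAle (seminorm_ge0 _ _ nrmS) andbT eq_sym.
    by apply: contraNneq x0 => /nrm0 ->.
  have nz : nrm ((nrm x)^-1 *: x) = 1 by rewrite nrmS.2 ger0_norm ?invr_ge0 ?(ltW nx0)// mulVf ?gt_eqF.
  have [u [ul un uz]] := hahn_banach nrm ((nrm x)^-1 *: x) (seminorm_sublinear _ nrmS).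
  exists (u, (nrm x)^-1 *: x) => _; split=> //=; first by rewrite uz.
  elim: (us) usl xk => //= t ts IHs [tl tsl] [xt xts]; split; last exact: IHs.
  by rewrite functionalZ// xt mulr0.
have [pick pickP] := choice ex.
pose L := fix L n := if n is m.+1 then (pick (L m)).1 :: L m else [::].
have Ll n : foldr (fun u P => functional u /\ P) True (L n).
  by elim: n => //= n IH; split=> //; have [[]] := pickP (L n) IH.
exists (fun n => (pick (L n)).1), (fun n => (pick (L n)).2) => n.
have [p1 p2 p3 p4] := pickP (L n) (Ll n); split=> // i.
elim: n (pick (L n)).2 p4 {p1 p2 p3} => //= n IH z [zn zk].
by rewrite ltnS leq_eqVlt => /predU1P[->//|/IH]; exact.
Qed.

(** Normalised differences of consecutive terms of a pointwise convergent
    subsequence of separated functionals; their norms are between one and two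
    before normalisation. *)
Lemma weak_star_null : (forall x, nrm x = 0 -> x = 0) -> infinite_dimensional -> dual_ball_compact ->
  exists v : nat -> V -> R, [/\ forall n, dual_ball (v n),
    forall n e, 0 < e -> exists x, nrm x <= 1 /\ 1 - e < v n x &
    forall x e, 0 < e -> exists N, forall n, (N <= n)%N -> `|v n x| <= e].
Proof.
move=> nrm0 Vinf cpt; have [u [z uz]] := separated_functionals nrm0 Vinf.
have uB n : dual_ball (u n) by have [] := uz n.
have [s [w [sS wl sw]]] := cpt u uB.
pose d n x := u (s n.+1) x - u (s n) x.
have dl n : functional (d n).
  by move=> a x y; rewrite /d (uB _).1 (uB (s n)).1; ring.
have d2 n x : `|d n x| <= 2 * nrm x.
  apply: le_trans (ler_normB _ _) _.
  by rewrite mulr_natl mulr2n lerD//; exact: dual_ball_norm.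
pose D n := [set d n x | x in [set x | nrm x <= 1]].
have Dsup n : has_sup (D n).
  split; first by exists (d n 0); exists 0 => //=; rewrite (seminorm0 _ nrmS).
  exists 2 => _ [x /= x1 <-]; apply: le_trans (ler_norm _) _; apply: le_trans (d2 n x) _.
  by rewrite ler_piMr.
have D1 n : 1 <= sup (D n).
  have [_ z1 uz1 uz0] := uz (s n.+1).
  apply: (sup_upper_bound (Dsup n)); exists (z (s n.+1)); first by rewrite /= z1.
  by rewrite /d uz1 uz0// subr0.
have D0 n : 0 < sup (D n) by exact: lt_le_trans (D1 n).
exists (fun n x => (sup (D n))^-1 * d n x); split.
- move=> n; split; first by move=> a x y; rewrite dl; ring.
  move=> x; rewrite ler_pdivrMl//.
  have [x0|x0] := eqVneq (nrm x) 0.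
    have := d2 n x; rewrite x0 !mulr0; exact: le_trans (ler_norm _).
  have nx0 : 0 < nrm x by rewrite lt_neqAle eq_sym x0 (seminorm_ge0 _ _ nrmS).
  have : d n ((nrm x)^-1 *: x) <= sup (D n).
    apply: (sup_upper_bound (Dsup n)); exists ((nrm x)^-1 *: x) => //=.
    by rewrite nrmS.2 ger0_norm ?invr_ge0 ?(ltW nx0)// mulVf.
  by rewrite functionalZ// ler_pdivrMl// mulrC.
- move=> n e e0; have ea : 0 < sup (D n) * e by rewrite mulr_gt0.
  have [_ [x x1 <-] Hx] := sup_adherent ea (Dsup n); exists x; split=> //.
  by rewrite -ltr_pdivrMl ?invr_gt0// invrK mulrBr mulr1.
- move=> x e e0; have e20 : 0 < e / 2 by rewrite divr_gt0.
  have [N HN] := sw x _ e20; exists N => n Nn.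
  rewrite normrM ger0_norm ?invr_ge0 ?(ltW (D0 n))// ler_pdivrMl//.
  apply: (@le_trans _ _ (1 * e)); last by rewrite ler_pM2r.
  have := HN n.+1 (leqW Nn); have := HN n Nn; rewrite /d !ler_norml.
  by move=> /andP[? ?] /andP[? ?]; apply/andP; split; lra.
Qed.

End FunctionalDichotomy.

(** * Real and complex scalars *)
Section Scalars.
Context {R : realType} {k : scalar_kind}.
Local Notation K := (scalars R k).

Definition of_real : R -> K :=
  match k return R -> scalars R k with
  | RealScalars => fun x => x
  | ComplexScalars => fun x => real_complex R x
  end.

Lemma re_of_real x : re (of_real x) = x.
Proof. by rewrite /of_real; case: k. Qed.

Lemma of_realD x y : of_real (x + y) = of_real x + of_real y.
Proof. by rewrite /of_real; case: k => //; rewrite rmorphD. Qed.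

Lemma of_realM x y : of_real (x * y) = of_real x * of_real y.
Proof. by rewrite /of_real; case: k => //; rewrite rmorphM. Qed.

Lemma of_real1 : of_real 1 = 1.
Proof. by rewrite /of_real; case: k. Qed.

Lemma of_real0 : of_real 0 = 0.
Proof. by rewrite /of_real; case: k. Qed.

Lemma reD (z w : K) : re (z + w) = re z + re w.
Proof. by move: z w; rewrite /re; case: k => //= -[? ?] [? ?]. Qed.

Lemma reZ a (z : K) : re (of_real a * z) = a * re z.
Proof. by move: z; rewrite /re /of_real; case: k => //= -[x y] /=; rewrite mul0r subr0. Qed.

Lemma ler_of_real x y : (of_real x <= of_real y) = (x <= y).
Proof. by rewrite /of_real; case: k => //; rewrite lecR. Qed.

Lemma ltr_of_real x y : (of_real x < of_real y) = (x < y).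
Proof. by rewrite /of_real; case: k => //; rewrite ltcR. Qed.

Lemma ge0_of_real (z : K) : 0 <= z -> of_real (re z) = z.
Proof.
by move: z; rewrite /re /of_real; case: k => //= z /ger0_Im; case: z => x y /= ->.
Qed.

Lemma re_le (z w : K) : z <= w -> re z <= re w.
Proof. by move: z w; rewrite /re; case: k => //= -[? ?] [? ?]; rewrite lecE => /andP[]. Qed.

Lemma re_lt (z w : K) : z < w -> re z < re w.
Proof. by move: z w; rewrite /re; case: k => //= -[? ?] [? ?]; rewrite ltcE => /andP[]. Qed.

Lemma norm_of_real (V : normedZmodType K) (x : V) : of_real (re `|x|) = `|x|.
Proof. exact: ge0_of_real. Qed.

Lemma re_norm_ge0 (V : normedZmodType K) (x : V) : 0 <= re `|x|.
Proof. by rewrite -ler_of_real of_real0 norm_of_real. Qed.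

Lemma re0 : re (0 : K) = 0. Proof. by rewrite -of_real0 re_of_real. Qed.
Lemma re1 : re (1 : K) = 1. Proof. by rewrite -of_real1 re_of_real. Qed.

Lemma re_normD (V : normedZmodType K) (x y : V) : re `|x + y| <= re `|x| + re `|y|.
Proof. by rewrite -reD; apply: re_le; exact: ler_normD. Qed.

Lemma reM_norm (V : normedZmodType K) (x : V) (z : K) : re (`|z| * `|x|) = re `|z| * re `|x|.
Proof. by rewrite -{1}(norm_of_real _ z) reZ. Qed.

Lemma re_norm_of_real a : re `|of_real a| = `|a|.
Proof.
rewrite /re /of_real; case: k => //=.
by rewrite expr0n addr0 sqrtr_sqr.
Qed.

Lemma re_le_norm (z : K) : `|re z| <= re `|z|.
Proof.
move: z; rewrite /re; case: k => // z.
by have := normc_ge_Re z; rewrite lecE => /andP[_ /=].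
Qed.

(** Take [j = 0] for real scalars and the imaginary unit for complex ones. *)
Lemma re_norm_le : exists j : K, `|j| <= 1 /\ forall z : K, re `|z| <= `|re z| + `|re (j * z)|.
Proof.
rewrite /re; case: k => /=; first by exists 0; rewrite normr0 ler01; split=> // z; rewrite mul0r normr0 addr0.
exists ('i%C : R[i]); split.
  by have /= -> := normc_def ('i%C : R[i]); rewrite expr0n expr1n add0r sqrtr1.
move=> [x y] /=; rewrite !mul0r !mul1r sub0r normrN.
rewrite -[leRHS]ger0_norm ?addr_ge0// -sqrtr_sqr ler_wsqrtr//.
rewrite sqrrD !real_normK ?num_real// -addrA lerD2l lerDr mulrn_wge0// mulr_ge0//.
Qed.

Lemma phase (z : K) : exists c : K, `|c| = 1 /\ c * z = `|z|.
Proof.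
have [->|z0] := eqVneq z 0; first by exists 1; rewrite normr1 mulr0 normr0.
exists (`|z| / z); rewrite divfK// normrM normrV ?unitfE// normr_id divff// normr_eq0//.
Qed.

End Scalars.

Definition linear_of (K : pzRingType) (X Y : lmodType K) (f : X -> Y) (lf : linear f) : {linear X -> Y} :=
  HB.pack f (GRing.isLinear.Build K X Y _ f lf).

(** [X] as a real vector space, by restriction of scalars. *)
Definition realify (R : realType) (k : scalar_kind) (X : normedModType (scalars R k)) : Type := X.

Section Realify.
Context {R : realType} {k : scalar_kind} (X : normedModType (scalars R k)).
Local Notation K := (scalars R k).

HB.instance Definition _ := GRing.Zmodule.on (realify R k X).

Let scale (a : R) (x : realify R k X) : realify R k X := (of_real a : K) *: (x : X).

Let scaleA a b x : scale a (scale b x) = scale (a * b) x.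
Proof. by rewrite /scale scalerA of_realM. Qed.
Let scale1 : left_id 1 scale.
Proof. by move=> x; rewrite /scale of_real1 scale1r. Qed.
Let scaleDr : right_distributive scale +%R.
Proof. by move=> a x y; rewrite /scale -scalerDr. Qed.
Let scaleDl x : {morph scale^~ x : a b / a + b}.
Proof. by move=> a b; rewrite /scale of_realD scalerDl. Qed.

HB.instance Definition _ := GRing.Zmodule_isLmodule.Build R (realify R k X) scaleA scale1 scaleDr scaleDl.

Definition scalar_seminorm (p : X -> R) :=
  (forall x y, p (x + y) <= p x + p y) /\ (forall (c : K) x, p (c *: x) = re `|c| * p x).

Lemma scalar_seminorm_real p : scalar_seminorm p -> seminorm (p : realify R k X -> R).
Proof.
move=> [pD pZ]; split=> [x y|a x]; first exact: pD.
by rewrite pZ re_norm_of_real.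
Qed.

Lemma scalar_seminorm_norm : scalar_seminorm (fun x => re `|x|).
Proof.
split=> [x y|c x]; first exact: re_normD.
by rewrite normrZ reM_norm.
Qed.

End Realify.

(** A complex functional with real part [u] is [u x - i u (i x)]. *)
Lemma functional_linear (R : realType) (k : scalar_kind) (X : normedModType (scalars R k))
  (u : realify R k X -> R) : functional u -> exists U : {linear X -> (scalars R k)^o}, forall x, re (U x) = u x.
Proof.
destruct k => ul.
  have lu : linear (u : X -> R^o) by move=> a x y; exact: ul.
  by exists (linear_of _ _ _ _ lu).
pose f (x : X) : (scalars R ComplexScalars)^o := ((u x) +i* (- u (('i%C : R[i]) *: x)))%C.
have lf : linear f.
  have ul' (c : R) (z w : X) : u ((of_real c : scalars R ComplexScalars) *: z + w) = c * u z + u w.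
    exact: ul.
  move=> [a b] x y; rewrite /f.
  set ii := ('i%C : R[i]).
  have e1 : ((a +i* b)%C : R[i]) = real_complex R a + real_complex R b * ii.
    by rewrite [LHS]complexE /= mulrC.
  have e2 : ((a +i* b)%C : R[i]) *: x + y =
      (real_complex R a : R[i]) *: x + ((real_complex R b : R[i]) *: (ii *: x) + y).
    by rewrite e1 scalerDl scalerA addrA.
  have e3 : ii *: (((a +i* b)%C : R[i]) *: x + y) =
      (real_complex R a : R[i]) *: (ii *: x) + ((real_complex R (- b) : R[i]) *: x + ii *: y).
    rewrite e2 !scalerDr !scalerA addrA addrA; congr (_ *: _ + _ *: _ + _); first by rewrite mulrC.
    by rewrite mulrAC -expr2 sqr_i mulN1r rmorphN.
  rewrite e3 e2 !ul'.
  apply/eqP; rewrite eq_complex /=; apply/andP; split; apply/eqP; ring.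
by exists (linear_of _ _ _ _ lf).
Qed.

(** The bound on the modulus follows from the one on the real part, by rotating
    [x] so that [U x] becomes a nonnegative real. *)
Lemma complexify (R : realType) (k : scalar_kind) (X : normedModType (scalars R k))
    (p : X -> R) (u : realify R k X -> R) : scalar_seminorm X p -> functional u ->
  (forall x, u x <= p x) ->
  exists U : {linear X -> (scalars R k)^o}, (forall x, re (U x) = u x) /\ forall x, re `|U x| <= p x.
Proof.
move=> pS ul up.
have [U Uu] := functional_linear R k X u ul.
exists U; split=> // x; have [c [c1 cU]] := phase (U x).
by rewrite -cU -[c * U x]/(c *: U x) -linearZ Uu (le_trans (up _))// pS.2 c1 re1 mul1r.
Qed.

(** * Suprema of seminorms *)
Lemma pigeonhole (R : realType) (T : Type) (A : R -> T -> Prop) (I : seq nat) (a : nat -> T -> R) (d : R) :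
  (forall e e' x, e <= e' -> A e x -> A e' x) -> 0 < d ->
  (forall e, 0 < e -> exists x, A e x /\ d <= \sum_(i <- I) a i x) ->
  exists i d', 0 < d' /\ forall e, 0 < e -> exists x, A e x /\ d' <= a i x.
Proof.
move=> Amono; elim: I d => [|i I IH] d d0 H.
  by have [x [_]] := H 1 ltr01; rewrite big_nil leNgt d0.
have d20 : 0 < d / 2 by rewrite divr_gt0.
have [h|/existsNP[e0 /not_implyP[e00 /forallNP Hi]]] :=
  pselect (forall e, 0 < e -> exists x, A e x /\ d / 2 <= a i x); first by exists i, (d / 2).
apply: (IH (d / 2) d20) => e e1; have [|x [Ax]] := H (Num.min e e0); first by rewrite lt_min e1.
rewrite big_cons => Hx; exists x; split; first by apply: Amono Ax; rewrite ge_min lexx.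
have : a i x < d / 2.
  rewrite ltNge; apply/negP => h; apply: (Hi x); split=> //.
  by apply: Amono Ax; rewrite ge_min lexx orbT.
lra.
Qed.

Section SupSeminorm.
Context {R : realType} {k : scalar_kind} {X : normedModType (scalars R k)}.
Local Notation K := (scalars R k).
Local Notation nrm := (fun x : X => re `|x|).
Local Notation scalar_seminorm := (scalar_seminorm X).

Lemma scalar_seminorm_ge0 p x : scalar_seminorm p -> 0 <= p x.
Proof. by move=> /scalar_seminorm_real pS; exact: (seminorm_ge0 _ _ pS). Qed.

(** The supremum of the [c_n q_n] with [c_n = 1 - 1 / (n + 2)].  At a given point,
    all but finitely many [q_n] are at most [L], and the others are multiplied by
    a factor smaller than one. *)
Lemma sup_seminorms (q : nat -> X -> R) (s : X -> R) (d L : R) :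
  (forall n, scalar_seminorm (q n)) -> (forall n x, q n x <= nrm x) -> L < 1 ->
  (forall x, nrm x <= 1 -> exists N, forall n, (N <= n)%N -> q n x <= L) ->
  (forall n e, 0 < e -> exists x, [/\ nrm x <= 1, 1 - e < q n x & d <= s x]) ->
  exists p : X -> R, [/\ scalar_seminorm p, forall x, p x <= nrm x, forall x, nrm x <= 1 -> p x < 1 &
    forall e, 0 < e -> exists x, [/\ nrm x <= 1, 1 - e < p x & d <= s x]].
Proof.
move=> qS qn L1 qL qd.
pose c n : R := 1 - n.+2%:R^-1.
have c01 n : 0 <= c n < 1.
  by apply/andP; split; [rewrite subr_ge0 invf_le1 ?ler1n|rewrite gtrBl invr_gt0].
have c0 n : 0 <= c n by have /andP[] := c01 n.
have c1 n : c n < 1 by have /andP[] := c01 n.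
have cmono m n : (m <= n)%N -> c m <= c n.
  by move=> mn; rewrite lerB// lef_pV2 ?posrE// ler_nat.
pose Q x := [set c n * q n x | n in [set: nat]].
have cq n x : c n * q n x <= nrm x.
  apply: le_trans (qn n x); apply: ler_piMl; [exact: scalar_seminorm_ge0|exact: ltW].
have Qsup x : has_sup (Q x).
  split; first by exists (c 0%N * q 0%N x); exists 0%N.
  by exists (nrm x) => _ [n _ <-].
have Qle n x : c n * q n x <= sup (Q x) by apply: (sup_upper_bound (Qsup x)); exists n.
have leQ x b : (forall n, c n * q n x <= b) -> sup (Q x) <= b.
  by move=> H; apply: ge_sup => [|_ [n _ <-]//]; exists (c 0%N * q 0%N x); exists 0%N.
exists (fun x => sup (Q x)); split.
- have hom (a : K) x : sup (Q (a *: x)) <= re `|a| * sup (Q x).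
    apply: leQ => n; rewrite (qS n).2 mulrCA ler_wpM2l//; exact: re_norm_ge0.
  split=> [x y|a x].
    apply: leQ => n; apply: le_trans (lerD (Qle n x) (Qle n y)).
    by rewrite -mulrDr ler_wpM2l// (qS n).1.
  apply/eqP; rewrite eq_le hom/=.
  have [->|a0] := eqVneq a 0.
    rewrite normr0 re0 mul0r; apply: le_trans (Qle 0%N _).
    by rewrite mulr_ge0//; exact: scalar_seminorm_ge0.
  have na0 : 0 < re `|a| by rewrite -(re0 (R := R) (k := k)); apply: re_lt; rewrite normr_gt0.
  have := hom a^-1 (a *: x); rewrite scalerA mulVf// scale1r normrV ?unitfE//.
  have -> : re (`|a|^-1) = (re `|a|)^-1.
    apply: (@mulfI _ (re `|a|)); rewrite ?gt_eqF// divff ?gt_eqF//.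
    by rewrite -reZ norm_of_real divff ?normr_eq0// re1.
  by rewrite ler_pdivlMl.
- by move=> x; apply: leQ.
- move=> x x1; have [N HN] := qL x x1.
  apply: (@le_lt_trans _ _ (Num.max (Num.max L 0) (c N))); last by rewrite !gt_max L1 ltr01 c1.
  apply: leQ => n; rewrite !le_max; have [Nn|nN] := leqP N n.
    apply/orP; left; have [q0|q0] := leP (q n x) 0.
      by apply/orP; right; rewrite mulr_ge0_le0.
    by apply/orP; left; apply: le_trans (HN n Nn); apply: ler_piMl; exact: ltW.
  apply/orP; right; apply: le_trans (cmono _ _ (ltnW nN)).
  by rewrite ler_piMr// (le_trans (qn n x)).
- move=> e e0; have e20 : 0 < e / 2 by rewrite divr_gt0.
  have [n nP] : exists n, n.+2%:R^-1 < e / 2.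
    exists (Num.truncn (e / 2)^-1); rewrite -[ltRHS]invrK ltf_pV2 ?posrE ?invr_gt0//.
    apply: lt_trans (truncnS_gt _) _; by rewrite ltr_nat.
  have [x [x1 qx sx]] := qd n _ e20; exists x; split=> //.
  apply: lt_le_trans (Qle n x); rewrite /c mulrBl mul1r.
  have : n.+2%:R^-1 * q n x <= n.+2%:R^-1 by apply: ler_piMr; [rewrite invr_ge0|exact: le_trans (qn n x) x1].
  move: nP; set b := n.+2%:R^-1; lra.
Qed.

Lemma normalize_seminorm (q : X -> R) : scalar_seminorm q -> (exists C, forall x, q x <= C * nrm x) ->
  (exists x, 0 < q x) ->
  exists Phi, [/\ 0 < Phi, forall x, q x <= Phi * nrm x &
    forall e, 0 < e -> exists x, nrm x <= 1 /\ Phi - e < q x].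
Proof.
move=> qS [C qC] [x0 qx0].
have nS := scalar_seminorm_real _ _ (scalar_seminorm_norm X).
pose D := [set q x | x in [set x | nrm x <= 1]].
have C0 : 0 <= C.
  have := lt_le_trans qx0 (qC x0); have := re_norm_ge0 _ x0.
  by rewrite le_eqVlt => /predU1P[<-|n0]; rewrite ?mulr0 ?ltxx// pmulr_lgt0// => /ltW.
have Dsup : has_sup D.
  split; first by exists (q 0); exists 0 => //=; rewrite normr0 re0.
  by exists C => _ [x /= x1 <-]; apply: le_trans (qC x) _; rewrite ler_piMr.
have hom x : q x <= sup D * nrm x.
  have [x00|x00] := eqVneq (nrm x) 0.
    by rewrite x00 mulr0; have := qC x; rewrite x00 mulr0.
  have nx0 : 0 < nrm x by rewrite lt_neqAle eq_sym x00 re_norm_ge0.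
  have : q ((of_real (nrm x)^-1 : K) *: x) <= sup D.
    apply: (sup_upper_bound Dsup); exists ((of_real (nrm x)^-1 : K) *: x) => //=.
    by rewrite normrZ reM_norm re_norm_of_real ger0_norm ?invr_ge0 ?(ltW nx0)// mulVf.
  by rewrite qS.2 re_norm_of_real ger0_norm ?invr_ge0 ?(ltW nx0)// ler_pdivrMl// mulrC.
exists (sup D); split=> //.
  rewrite ltNge; apply/negP => h; have := lt_le_trans qx0 (hom x0).
  by rewrite ltNge => /negP; apply; rewrite mulr_le0_ge0// re_norm_ge0.
by move=> e e0; have [_ [x x1 <-] Hx] := sup_adherent e0 Dsup; exists x.
Qed.

End SupSeminorm.

(** * A seminorm that does not attain its norm *)
Section Core.
Context {R : realType} {k : scalar_kind} {X : normedModType (scalars R k)}.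
Local Notation K := (scalars R k).
Local Notation nrm := (fun x : X => re `|x|).
Local Notation scalar_seminorm := (scalar_seminorm X).
Local Notation V := (realify R k X).

Lemma infinite_dimensional_realify : ~ finite_dimensional X -> infinite_dimensional (V := V).
Proof.
move=> H [n [v vP]]; apply: H; exists n, (fun i : 'I_n => v i : X) => x.
by have [c cx] := vP x; exists (fun i : 'I_n => of_real (c i)).
Qed.

Lemma re_norm_eq0 (x : X) : re `|x| = 0 -> x = 0.
Proof. by move=> h; apply/eqP; rewrite -normr_eq0 -norm_of_real h of_real0. Qed.

Lemma seminorm_norm_functional (U : {linear X -> K^o}) : scalar_seminorm (fun x => re `|U x|).
Proof.
split=> [x y|c x]; first by rewrite linearD; exact: re_normD.
by rewrite linearZ /= normrM reM_norm.
Qed.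

Lemma seminorm_scale a p : 0 <= a -> scalar_seminorm p -> scalar_seminorm (fun x => a * p x).
Proof.
move=> a0 [pD pZ]; split=> [x y|c x]; first by rewrite -mulrDr ler_wpM2l.
by rewrite pZ mulrCA.
Qed.

Lemma seminorm_add p q : scalar_seminorm p -> scalar_seminorm q -> scalar_seminorm (fun x => p x + q x).
Proof.
move=> [pD pZ] [qD qZ]; split=> [x y|c x]; first by rewrite addrACA lerD.
by rewrite pZ qZ mulrDr.
Qed.

Lemma seminorm_sum (I : seq nat) (p : nat -> X -> R) : (forall i, scalar_seminorm (p i)) ->
  scalar_seminorm (fun x => \sum_(i <- I) p i x).
Proof.
move=> pS; split=> [x y|c x].
  by rewrite -big_split/=; apply: ler_sum => i _; exact: (pS i).1.
by rewrite mulr_sumr; apply: eq_bigr => i _; exact: (pS i).2.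
Qed.

Definition witness (p : X -> R) (F : {linear X -> K^o}) (C d : R) :=
  [/\ scalar_seminorm p, forall x, p x <= nrm x, forall x, nrm x <= 1 -> p x < 1,
    forall x, re `|F x| <= C * nrm x & 0 < d /\
    forall e, 0 < e -> exists x, [/\ nrm x <= 1, 1 - e < p x & d <= re `|F x|]].

Lemma witness_nonattaining (u : V -> R) : nonattaining (nrm := nrm : V -> R) u ->
  exists p F C d, witness p F C d.
Proof.
move=> [[ul un] u1 ue].
have [U [Uu Un]] := complexify R k X nrm u (scalar_seminorm_norm X) ul un.
exists (fun x => re `|U x|), U, 1, (1 / 2); split.
- exact: seminorm_norm_functional.
- exact: Un.
- move=> x x1; have [c [c1 cU]] := phase (U x).
  have : u ((c : K) *: x) < 1 by apply: u1; rewrite normrZ c1 mul1r.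
  by rewrite -Uu linearZ -cU.
- by move=> x; rewrite mul1r; exact: Un.
- split; first by rewrite divr_gt0.
  move=> e e0; have [|x [x1 xe]] := ue (Num.min e (1 / 2)); first by rewrite lt_min e0 divr_gt0.
  have h : u x <= re `|U x| by rewrite -Uu; apply: le_trans (ler_norm _) (re_le_norm _).
  have m1 : Num.min e (1 / 2) <= e by rewrite ge_min lexx.
  have m2 : Num.min e (1 / 2) <= 1 / 2 by rewrite ge_min lexx orbT.
  by exists x; split=> //; lra.
Qed.

Section WeakStarNull.
Context {v : nat -> {linear X -> K^o}}.
Context (vn : forall n x, re `|v n x| <= nrm x).
Context (v1 : forall n e, 0 < e -> exists x : X, nrm x <= 1 /\ 1 - e < re (v n x)).
Context (v0 : forall x e, 0 < e -> exists N, forall n, (N <= n)%N -> re `|v n x| <= e).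

Definition sum_seminorm (I : seq nat) x := \sum_(i <- I) re `|v i x|.

Let sum_scalar_seminorm I : scalar_seminorm (sum_seminorm I).
Proof. by apply: seminorm_sum => i; exact: seminorm_norm_functional. Qed.

(** Adding the finite sum over [I], normalised by [C], increases the norms of
    infinitely many [v n] from one to at least [1 + d]. *)
Definition heavy := exists I C d, [/\ 1 <= C, forall x, nrm x <= 1 -> sum_seminorm I x <= C, 0 < d &
  forall N, exists n, (N <= n)%N /\ exists x, nrm x <= 1 /\ 1 + d <= re `|v n x| + sum_seminorm I x / C].

(** The seminorms are [|v n| + q], divided by their norms [Phi n >= 1 + d]; at a
    fixed point of the ball their upper limit is at most [1 / (1 + d)].  Where they
    are close to one, [q >= d / 2]; by the pigeonhole principle, one summand of
    [q] stays above a positive constant at points where [p] is arbitrarily close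
    to one. *)
Lemma witness_heavy : heavy -> exists p F C d, witness p F C d.
Proof.
move=> [I [C [d [C1 IC d0 H]]]].
have C0 : 0 < C by exact: lt_le_trans C1.
pose q x := C^-1 * sum_seminorm I x.
have qS : scalar_seminorm q by apply: seminorm_scale; rewrite ?invr_ge0 ?ltW.
have q1 x : nrm x <= 1 -> q x <= 1 by move=> x1; rewrite ler_pdivrMl// mulr1 IC.
have [s [sS sP]] : exists s, strictly_increasing s /\ forall n,
    exists x, nrm x <= 1 /\ 1 + d <= re `|v (s n) x| + q x.
  have [|s [sS sP]] := enumeration [set n | exists x, nrm x <= 1 /\ 1 + d <= re `|v n x| + q x].
    move=> N; have [n [Nn [x [x1 xd]]]] := H N; exists n; split=> //.
    by exists x; split=> //; rewrite /q mulrC.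
  by exists s.
pose q' n x := re `|v (s n) x| + q x.
have q'S n : scalar_seminorm (q' n) by apply: seminorm_add => //; exact: seminorm_norm_functional.
have vn1 n x : nrm x <= 1 -> re `|v n x| <= 1 by apply: le_trans.
have qn x : q x <= nrm x.
  have [x0|x0] := eqVneq x 0; first by rewrite x0 -(scale0r 0) qS.2 !normr0 re0 mul0r normrZ normr0 mul0r re0.
  have nx0 : 0 < nrm x by rewrite lt_neqAle re_norm_ge0 andbT eq_sym; apply: contra_neq x0 => /re_norm_eq0.
  have := q1 ((of_real (nrm x)^-1 : K) *: x).
  rewrite normrZ reM_norm re_norm_of_real ger0_norm ?invr_ge0 ?(ltW nx0)// mulVf ?gt_eqF// => /(_ (lexx _)).
  by rewrite qS.2 re_norm_of_real ger0_norm ?invr_ge0 ?(ltW nx0)// ler_pdivrMl// mulr1.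
have [Phi PhiP] : exists Phi : nat -> R, forall n, [/\ 1 + d <= Phi n, forall x, q' n x <= Phi n * nrm x &
    forall e, 0 < e -> exists x, nrm x <= 1 /\ Phi n - e < q' n x].
  suff : forall n, exists P : R, [/\ 1 + d <= P, forall x, q' n x <= P * nrm x &
    forall e, 0 < e -> exists x, nrm x <= 1 /\ P - e < q' n x] by move/choice => -[Phi ?]; exists Phi.
  move=> n; have [x [x1 xd]] := sP n.
  have [||P [P0 Pq Pe]] := normalize_seminorm (q' n) (q'S n).
  - by exists 2 => y; rewrite mulr_natl mulr2n; exact: lerD.
  - by exists x; apply: lt_le_trans xd; rewrite addr_gt0.
  exists P; split=> //; apply: le_trans xd _; apply: le_trans (Pq x) _; rewrite ler_piMr// ltW//.
have P0 n : 0 < Phi n by have [h _ _] := PhiP n; apply: lt_le_trans h; rewrite addr_gt0.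
have dd : 0 < 1 + d by rewrite addr_gt0.
have [|||||p [pS pn p1 pe]] := @sup_seminorms R k X
  (fun n x => (Phi n)^-1 * q' n x) q (d / 2) ((1 + d / 2) / (1 + d)).
- by move=> n; apply: seminorm_scale => //; rewrite invr_ge0 ltW.
- by move=> n x; have [_ h _] := PhiP n; rewrite ler_pdivrMl.
- by rewrite ltr_pdivrMr// mul1r; lra.
- move=> x x1; have [|N HN] := v0 x (d / 2); first by rewrite divr_gt0.
  exists N => n Nn; rewrite ler_pdivrMl//; have [h _ _] := PhiP n.
  have := HN (s n) (leq_trans Nn (strictly_increasing_ge s n sS)).
  have : (1 + d / 2) <= Phi n * ((1 + d / 2) / (1 + d)).
    by rewrite mulrA ler_pdivlMr// mulrC ler_wpM2r// addr_ge0// divr_ge0// ltW.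
  rewrite /q'; have := q1 x x1; lra.
- move=> n e e0; have [h _ /(_ (Num.min (Phi n * e) (d / 2)))] := PhiP n.
  rewrite lt_min mulr_gt0// divr_gt0// => /(_ isT)[x [x1 xP]]; exists x; split=> //.
    rewrite -ltr_pdivrMl ?invr_gt0// invrK mulrBr mulr1; apply: le_lt_trans xP.
    by rewrite lerB// ge_min lexx.
  have : Num.min (Phi n * e) (d / 2) <= d / 2 by rewrite ge_min lexx orbT.
  move: xP; rewrite /q'; have := vn1 (s n) x x1; lra.
have [|||i [d' [d'0 Hi]]] := @pigeonhole R X
  (fun e x => nrm x <= 1 /\ 1 - e < p x) I (fun i x => re `|v i x|) (C * (d / 2)).
- by move=> e e' x ee' [x1 xe]; split=> //; apply: le_lt_trans xe; rewrite lerB.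
- by rewrite mulr_gt0// divr_gt0.
- move=> e e0; have [x [x1 xp xq]] := pe e e0; exists x; split=> //.
  by rewrite -ler_pdivlMl.
exists p, (v i), 1, d'; split=> //; first by move=> x; rewrite mul1r.
by split=> // e e0; have [x [[x1 xp] xi]] := Hi e e0; exists x.
Qed.

(* Bound on the unit ball for the sum of the first j selected moduli: it grows
   from 1 to 9 / 8. *)
Let budget j : R := 1 + (1 - (2 ^- j)) / 8.

(** Indices [m j] are selected one after the other, keeping the sum of the
    [|v (m j)|] at most 9 / 8 on the unit ball.  At a point where the real part of
    [v (m j)] is at least 7 / 8, the other terms add up to at most 1 / 4, and so the sum [f] of the
    real parts, realised as a cluster functional of the partial sums [S j], is at
    least 1 / 2 there. *)
Lemma witness_light : ~ heavy -> exists p F C d, witness p F C d.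
Proof.
move=> Hno.
have bS j : budget j.+1 = budget j + 2 ^- j.+1 / 8.
  by rewrite /budget exprS invfM; lra.
have b1 j : 1 <= budget j.
  have : 2 ^- j <= 1 :> R by rewrite invf_le1 ?exprn_gt0//; apply: exprn_ege1; rewrite ler1n.
  rewrite /budget; lra.
have b2 j : budget j <= 9 / 8.
  have : 0 <= 2 ^- j :> R by rewrite invr_ge0 exprn_ge0.
  rewrite /budget; lra.
have ex (jI : nat * seq nat) : exists n, (jI.1 <= n)%N /\
    ((forall x, nrm x <= 1 -> sum_seminorm jI.2 x <= budget jI.1) ->
     forall x, nrm x <= 1 -> sum_seminorm (n :: jI.2) x <= budget jI.1.+1).
  case: jI => j I /=.
  have [Ij|] := pselect (forall x, nrm x <= 1 -> sum_seminorm I x <= budget j); last by exists j.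
  have d0 : 0 < 2 ^- j.+1 / 8 :> R by rewrite divr_gt0// invr_gt0 exprn_gt0.
  apply: contrapT => /forallNP H; apply: Hno; exists I, (budget j), (2 ^- j.+1 / 8); split=> //.
  move=> N; have /not_andP[|/not_implyP[_ /existsNP[x /not_implyP[x1 /negP xb]]]] := H (maxn N j).
    by rewrite leq_maxr.
  exists (maxn N j); split; first exact: leq_maxl.
  exists x; split=> //; move: xb; rewrite -ltNge bS /sum_seminorm big_cons -/(sum_seminorm I x).
  have B0 : 0 < budget j by exact: lt_le_trans (b1 j).
  (* dividing the sum by the budget costs at most budget j - 1 *)
  have : sum_seminorm I x - sum_seminorm I x / budget j <= budget j - 1.
    have -> : sum_seminorm I x - sum_seminorm I x / budget j = (1 - (budget j)^-1) * sum_seminorm I x by ring.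
    have -> : budget j - 1 = (1 - (budget j)^-1) * budget j by rewrite mulrBl mul1r mulVf ?gt_eqF.
    by rewrite ler_wpM2l ?Ij// subr_ge0 invf_le1.
  by move=> ? ?; lra.
have [pick pickP] := choice ex.
pose I := fix I j := if j is i.+1 then pick (i, I i) :: I i else [::].
pose m j := pick (j, I j).
have mj j : (j <= m j)%N by exact: (pickP (j, I j)).1.
have IP j x : nrm x <= 1 -> sum_seminorm (I j) x <= budget j.
  elim: j x => [|j IH] x x1; first by rewrite /sum_seminorm big_nil (le_trans _ (b1 _)).
  exact: (pickP (j, I j)).2.
pose S j (x : V) := \sum_(i <- I j) re (v i x).
have SS j x : S j.+1 x = re (v (m j) x) + S j x by rewrite /S /= big_cons.
have sumS j x : sum_seminorm (I j.+1) x = re `|v (m j) x| + sum_seminorm (I j) x.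
  by rewrite /sum_seminorm /= big_cons.
have vl n : functional (fun x : V => re (v n x)).
  by move=> a x y; rewrite linearP reD -reZ.
have Sl j : functional (S j).
  elim: j => [|j IH] a x y; first by rewrite /S !big_nil mulr0 addr0.
  by rewrite !SS IH vl; ring.
have Sle j x : `|S j x| <= sum_seminorm (I j) x.
  apply: le_trans (ler_norm_sum _ _ _) _; apply: ler_sum => i _; exact: re_le_norm.
have nV := scalar_seminorm_real _ _ (scalar_seminorm_norm X).
have Sn j x : S j x <= 9 / 8 * nrm x.
  have [x0|x0] := eqVneq (x : X) 0.
    have -> : re `|x : X| = 0 by rewrite x0 normr0 re0.
    by rewrite mulr0 x0 (functional0 _ (Sl j)).
  have nx0 : 0 < nrm x by rewrite lt_neqAle re_norm_ge0 andbT eq_sym; apply: contra_neq x0 => /re_norm_eq0.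
  have := IP j ((of_real (nrm x)^-1 : K) *: (x : X)).
  rewrite normrZ reM_norm re_norm_of_real ger0_norm ?invr_ge0 ?(ltW nx0)// mulVf ?gt_eqF// => /(_ (lexx _)).
  rewrite (sum_scalar_seminorm _).2 re_norm_of_real ger0_norm ?invr_ge0 ?(ltW nx0)// ler_pdivrMl// => h.
  apply: le_trans (ler_norm _) _; apply: le_trans (Sle j x) _; apply: le_trans h _.
  by rewrite mulrC ler_wpM2r// ltW.
have n98 : scalar_seminorm (fun x => 9 / 8 * nrm x).
  by apply: seminorm_scale; [lra|exact: scalar_seminorm_norm].
have n98R := scalar_seminorm_real _ _ n98.
have [f fS] : exists f, tracks f S.
  apply: (cluster_functional (fun x : V => 9 / 8 * nrm x)) => // j x.
  by apply: (functional_norm_le (S j) _ x n98R (Sl j)) => y; exact: Sn.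
have fn x : f x <= 9 / 8 * nrm x by apply: (tracks_ub f S x _ 0%N Sl fS) => j _; exact: Sn.
have [F [Ff Fn]] := complexify R k X _ f n98 fS.1 fn.
have [|||||p [pS pn p1 pe]] := @sup_seminorms R k X
  (fun j x => re `|v (m j) x|) (fun x => re `|F x|) (1 / 2) (1 / 2).
- by move=> j; exact: seminorm_norm_functional.
- by [].
- lra.
- move=> x x1; have [|N HN] := v0 x (1 / 2); first lra.
  by exists N => j Nj; apply: HN; exact: leq_trans (mj j).
- move=> j e e0; have [|x [x1 xe]] := v1 (m j) (Num.min e (1 / 8)).
    by rewrite lt_min e0; lra.
  have m1 : Num.min e (1 / 8) <= e by rewrite ge_min lexx.
  have m2 : Num.min e (1 / 8) <= 1 / 8 by rewrite ge_min lexx orbT.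
  have vx : re (v (m j) x) <= re `|v (m j) x| by apply: le_trans (ler_norm _) (re_le_norm _).
  exists x; split=> //; first lra.
  have Sd i : (j < i)%N -> `|S i x - re (v (m j) x)| <= sum_seminorm (I i) x - re `|v (m j) x|.
    elim: i => // i IH; rewrite ltnS leq_eqVlt => /predU1P[<-|/IH {}IH].
      by rewrite SS sumS addrC addKr [leRHS]addrC addKr; exact: Sle.
    rewrite SS sumS -!addrA; apply: le_trans (ler_normD _ _) _.
    by rewrite lerD//; exact: re_le_norm.
  have : `|f x - re (v (m j) x)| <= 1 / 4.
    apply: (tracks_dist f S (fun x => re (v (m j) x)) j.+1 _ _ Sl fS) => i ji.
    apply: le_trans (Sd i ji) _; have := IP i x x1; have := b2 i; lra.
  rewrite ler_norml => /andP[+ _] => h.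
  have : f x <= re `|F x| by rewrite -Ff; apply: le_trans (ler_norm _) (re_le_norm _).
  lra.
exists p, F, (9 / 8), (1 / 2); split=> //; split=> //; lra.
Qed.

End WeakStarNull.

Theorem exists_witness : ~ finite_dimensional X -> exists p F C d, witness p F C d.
Proof.
move=> /infinite_dimensional_realify Vinf.
have nS := scalar_seminorm_real _ _ (scalar_seminorm_norm X).
have [[u uP]|cpt] := nonattaining_or_compact nS; first exact: witness_nonattaining uP.
have [u [uB u1 u0]] := weak_star_null nS re_norm_eq0 Vinf cpt.
have /choice[v vP] : forall n, exists U : {linear X -> K^o},
    (forall x, re (U x) = u n x) /\ forall x, re `|U x| <= nrm x.
  by move=> n; apply: complexify; [exact: scalar_seminorm_norm|exact: (uB n).1|exact: (uB n).2].
have v1 n e : 0 < e -> exists x : X, nrm x <= 1 /\ 1 - e < re (v n x).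
  by move=> e0; have [x [x1 xe]] := u1 n e e0; exists x; rewrite (vP n).1.
have v0 x e : 0 < e -> exists N, forall n, (N <= n)%N -> re `|v n x| <= e.
  move=> e0; have [j [_ jP]] := re_norm_le (R := R) (k := k).
  have e20 : 0 < e / 2 by rewrite divr_gt0.
  have [N1 H1] := u0 x _ e20; have [N2 H2] := u0 ((j : K) *: x) _ e20.
  exists (maxn N1 N2) => n; rewrite geq_max => /andP[/H1 h1 /H2 h2].
  apply: le_trans (jP _) _; rewrite (vP n).1 -[j * _]/(j *: v n x) -linearZ (vP n).1; lra.
have vn n x := (vP n).2 x.
have [h|h] := pselect (heavy (v := v)); first exact: witness_heavy h.
exact: witness_light h.
Qed.

End Core.

(** * The superspace *)
Lemma scalars_complete (R : realType) (k : scalar_kind) (F : set_system (scalars R k)^o) :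
  ProperFilter F -> cauchy F -> cvg F.
Proof.
destruct k => FF /cauchyP Fc; first by apply: R_complete; apply/cauchyP.
have part (g : R[i] -> R) : (forall z w, g (z - w) = g z - g w) -> (forall z, `|g z| <= complex.Re `|z|) ->
    exists l : R, g @ F --> l.
  move=> gB gn; apply/cvg_ex; apply: R_complete; apply/cauchyP => e e0.
  have [|z zF] := Fc (real_complex R e); first by rewrite ltcR.
  exists (g z); suff : \forall w \near F, ball (g z) e (g w) by [].
  apply: filterS zF => w /=; rewrite -!ball_normE /= -gB => h.
  apply: le_lt_trans (gn _) _; by move: h; rewrite ltcE => /andP[].
have [a aP] : exists l : R, (@complex.Re R) @ F --> l.
  apply: part => [[? ?] [? ?]//|z]; exact: (@re_le_norm R ComplexScalars z).
have [b bP] : exists l : R, (@complex.Im R) @ F --> l.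
  apply: part => [[? ?] [? ?]//|[x y]] /=.
  by rewrite -sqrtr_sqr ler_wsqrtr// lerDr sqr_ge0.
apply/cvg_ex; exists (Complex a b : (scalars R ComplexScalars)^o); apply/cvgrPdist_lt => e e0.
have e1 : 0 < complex.Re e / 2.
  by rewrite divr_gt0//; move: e0; rewrite ltcE => /andP[].
move: aP => /cvgrPdist_lt/(_ _ e1) aP; move: bP => /cvgrPdist_lt/(_ _ e1) bP.
apply: filterS2 aP bP => -[x y] /= ax yb.
rewrite -(@ge0_of_real R ComplexScalars e (ltW e0)) -(@norm_of_real R ComplexScalars).
rewrite (@ltr_of_real R ComplexScalars) /=.
rewrite -[ltLHS]ger0_norm ?sqrtr_ge0//.
apply: (@le_lt_trans _ _ (`|a - x| + `|b - y|)); last by move: ax yb; lra.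
rewrite ger0_norm ?sqrtr_ge0// -[leRHS]ger0_norm ?addr_ge0// -sqrtr_sqr ler_wsqrtr//.
by rewrite [leRHS]sqrrD !real_normK ?num_real// [leRHS]addrAC lerDl mulrn_wge0// mulr_ge0.
Qed.

Lemma bounded_functional_continuous (R : realType) (k : scalar_kind) (Y : normedModType (scalars R k))
  (phi : {linear Y -> (scalars R k)^o}) : (forall y, re `|phi y| <= re `|y|) -> continuous phi.
Proof.
move=> phib; apply: bounded_linear_continuous; apply/linear_boundedP.
near=> r => y; apply: (@le_trans _ _ (1 * `|y|)).
  by rewrite mul1r -norm_of_real -(norm_of_real _ y) ler_of_real.
by rewrite ler_wpM2r//; near: r; exact: nbhs_pinfty_ge.
Unshelve. all: by end_near. Qed.

Lemma closed_kernel (R : realType) (k : scalar_kind) (Y : normedModType (scalars R k))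
  (phi : {linear Y -> (scalars R k)^o}) : (forall y, re `|phi y| <= re `|y|) -> closed [set y | phi y = 0].
Proof.
move=> /bounded_functional_continuous phic.
have : closed (phi @^-1` [set 0]); last by [].
apply: closed_comp => [y _|]; first exact: phic.
exact: (accessible_closed_set1 (hausdorff_accessible (@norm_hausdorff _ (scalars R k)^o))).
Qed.

Section Superspace.
Context {R : realType} {k : scalar_kind} {X : completeNormedModType (scalars R k)}.
Local Notation K := (scalars R k).
Local Notation nrm := (fun x : X => re `|x|).

(** The seminorm and its properties are arguments, so that the norm of the
    superspace can be inferred from its type. *)
Definition superspace (p : X -> R) (pS : scalar_seminorm X p) (pn : forall x, p x <= re `|x|) : Type :=
  (X * K^o)%type.

Section Instances.
Context (p : X -> R) (pS : scalar_seminorm X p) (pn : forall x, p x <= re `|x|).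
Local Notation Y := (superspace p pS pn).

HB.instance Definition _ := GRing.Lmodule.copy Y (X * K^o)%type.

Definition super_norm (y : Y) : R := Num.max (re `|y.1|) (p y.1 + re `|y.2|).

Let normD (y z : Y) : of_real (super_norm (y + z)) <= of_real (super_norm y) + of_real (super_norm z) :> K.
Proof.
rewrite -of_realD ler_of_real /super_norm.
have -> : (y + z).1 = y.1 + z.1 by [].
have -> : (y + z).2 = y.2 + z.2 by [].
rewrite ge_max; apply/andP; split.
  by apply: le_trans (re_normD X y.1 z.1) _; apply: lerD; rewrite le_max lexx.
apply: le_trans (lerD (pS.1 _ _) (re_normD K^o y.2 z.2)) _; rewrite addrACA.
by apply: lerD; rewrite le_max lexx orbT.
Qed.

Let normZ (c : K) (y : Y) : of_real (super_norm (c *: y)) = `|c| * of_real (super_norm y).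
Proof.
rewrite -(norm_of_real _ c) -of_realM; congr of_real; rewrite /super_norm /=.
by rewrite maxr_pMr ?re_norm_ge0// normrZ reM_norm pS.2 mulrDr normrM reM_norm.
Qed.

Let norm0 (y : Y) : of_real (super_norm y) = 0 :> K -> y = 0.
Proof.
rewrite -of_real0 => h; have {}h : super_norm y = 0.
  by rewrite -(re_of_real (k := k) (super_norm y)) h re_of_real.
have h1 : re `|y.1| = 0.
  by apply/eqP; rewrite eq_le re_norm_ge0 andbT -h le_max lexx.
have h2 : re `|y.2| = 0.
  apply/eqP; rewrite eq_le re_norm_ge0 andbT -h le_max; apply/orP; right.
  by rewrite lerDr; exact: scalar_seminorm_ge0.
case: y h1 h2 {h} => x a /= /re_norm_eq0 -> h2; congr pair.
by apply/eqP; rewrite -normr_eq0 -norm_of_real h2 of_real0.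
Qed.

HB.instance Definition _ := Lmodule_isNormed.Build K Y normD normZ norm0.

Lemma super_normE (y : Y) : `|y| = of_real (super_norm y). Proof. by []. Qed.

Lemma re_super_norm (y : Y) : re `|y| = super_norm y. Proof. by rewrite super_normE re_of_real. Qed.

Lemma fst_super_norm (y : Y) : re `|y.1| <= super_norm y.
Proof. by rewrite le_max lexx. Qed.

Lemma snd_super_norm (y : Y) : p y.1 + re `|y.2| <= super_norm y.
Proof. by rewrite le_max lexx orbT. Qed.

Lemma snd_le_super_norm (y : Y) : re `|y.2| <= super_norm y.
Proof. by apply: le_trans (snd_super_norm y); rewrite lerDr; exact: scalar_seminorm_ge0. Qed.

Lemma super_norm_le (y : Y) : super_norm y <= re `|y.1| + re `|y.2|.
Proof. by rewrite ge_max lerDl re_norm_ge0 lerD2r pn. Qed.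

Let super_complete (F : set_system Y) : ProperFilter F -> cauchy F -> cvg F.
Proof.
move=> FF /cauchyP Fc.
have c1 : cvg (fst @ F : set_system X).
  apply: cauchy_cvg; apply/cauchyP => e e0; have [y yF] := Fc e e0; exists y.1.
  suff : \forall z \near F, ball y.1 e z.1 by [].
  apply: filterS yF => z; rewrite -!ball_normE /=; apply: le_lt_trans.
  by rewrite super_normE -norm_of_real ler_of_real; exact: (fst_super_norm (y - z)).
have c2 : cvg (snd @ F : set_system K^o).
  apply: scalars_complete; apply/cauchyP => e e0; have [y yF] := Fc e e0; exists y.2.
  suff : \forall z \near F, ball (y.2 : K^o) e z.2 by [].
  apply: filterS yF => z; rewrite -!ball_normE /=; apply: le_lt_trans.
  by rewrite super_normE -norm_of_real ler_of_real; exact: (snd_le_super_norm (y - z)).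
move: c1 c2 => /cvg_ex[x xP] /cvg_ex[a aP].
apply/cvg_ex; exists ((x, a) : Y); apply/cvgrPdist_lt => e e0.
have e20 : 0 < e / 2 by rewrite divr_gt0.
move: xP aP => /cvgrPdist_lt/(_ _ e20) xP /cvgrPdist_lt/(_ _ e20) aP.
apply: filterS2 xP aP => y /= h1 h2.
rewrite super_normE (splitr e) (le_lt_trans _ (ltrD h1 h2))//.
rewrite -(norm_of_real _ (x - y.1)) -(norm_of_real _ (a - y.2)) -of_realD ler_of_real.
exact: super_norm_le.
Qed.

HB.instance Definition _ := Uniform_isComplete.Build Y super_complete.

Definition super_incl (x : X) : Y := (x, 0).

Lemma super_incl_linear : linear super_incl.
Proof. by move=> a x y; rewrite /super_incl; congr pair; rewrite /= scaler0 addr0. Qed.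

Lemma super_norm_incl x : `|super_incl x| = `|x|.
Proof.
rewrite super_normE -norm_of_real; congr of_real; rewrite /super_norm /= normr0 re0 addr0.
exact: max_l.
Qed.

Definition super_op (F : {linear X -> K^o}) (x : X) : Y := (0, F x).

Lemma super_op_linear F : linear (super_op F).
Proof. by move=> a x y; rewrite /super_op; congr pair; rewrite /= ?linearP// scaler0 addr0. Qed.

Lemma seminorm_at0 : p 0 = 0.
Proof. by rewrite -(scale0r 0) pS.2 normr0 re0 mul0r. Qed.

Lemma super_norm_op F x : `|super_op F x| = `|F x|.
Proof.
rewrite super_normE -norm_of_real; congr of_real; rewrite /super_norm /= normr0 re0 seminorm_at0 add0r.
exact/max_r/re_norm_ge0.
Qed.

Lemma super_hyperplane : hyperplane (Y := Y) (range super_incl).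
Proof.
have rE (y : Y) : range super_incl y <-> y.2 = 0.
  by split=> [[x _ <-]//|]; case: y => x a /= ->; exists x.
split.
- have sl : linear (fun y : Y => y.2 : K^o) by [].
  have -> : range super_incl = [set y : Y | linear_of _ _ _ _ sl y = 0] by apply/seteqP; split=> y /rE.
  apply: closed_kernel => y; rewrite re_super_norm; exact: snd_le_super_norm.
- exact/rE.
- by move=> a x y /rE x2 /rE y2; apply/rE; rewrite /= x2 y2 scaler0 addr0.
- exists ((0, 1) : Y); split; first by move=> /rE /= /eqP; rewrite oner_eq0.
  by move=> y; exists (y.2 : K); apply/rE; rewrite /= -[_ *: 1]/(_ * 1) mulr1 subrr.
Qed.

End Instances.
End Superspace.

(** * The two numerical ranges *)
(** A set of reals without supremum has [sup] equal to zero, so a dual norm equal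
    to one is a genuine supremum. *)
Lemma dual_norm_le (R : realType) (k : scalar_kind) (Y : normedModType (scalars R k))
  (phi : {linear Y -> (scalars R k)^o}) : dual_norm phi = 1 -> forall y, re `|phi y| <= re `|y|.
Proof.
rewrite /dual_norm; set D := (X in sup X) => D1 y.
have Dsup : has_sup D.
  by apply: contrapT => /sup_out h; move: D1; rewrite h => /eqP; rewrite eq_sym oner_eq0.
have [->|y0] := eqVneq y 0; first by rewrite linear0 !normr0.
have ny0 : 0 < re `|y| by rewrite lt_neqAle re_norm_ge0 andbT eq_sym; apply: contra_neq y0 => /re_norm_eq0.
set y' := (of_real (re `|y|)^-1 : scalars R k) *: y.
have : re `|phi y'| <= sup D.
  apply: (sup_upper_bound Dsup); exists y' => //=.
  rewrite normrZ -(norm_of_real _ y) -(norm_of_real _ (of_real _)) -of_realM -of_real1 ler_of_real.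
  by rewrite re_norm_of_real re_of_real ger0_norm ?invr_ge0 ?(ltW ny0)// mulVf ?gt_eqF.
rewrite D1 linearZ /= normrM reM_norm re_norm_of_real ger0_norm ?invr_ge0 ?(ltW ny0)//.
by rewrite ler_pdivrMl// mulr1.
Qed.

Lemma dual_norm_eq1 (R : realType) (k : scalar_kind) (Y : normedModType (scalars R k))
  (phi : {linear Y -> (scalars R k)^o}) y0 : (forall y, re `|phi y| <= re `|y|) -> `|y0| = 1 -> `|phi y0| = 1 ->
  dual_unit_sphere phi.
Proof.
move=> phib y01 phi1; split; first exact: bounded_functional_continuous.
rewrite /dual_norm; set D := (X in sup X).
have Dle : ubound D 1.
  by move=> _ [y /= y1 <-]; apply: le_trans (phib y) _; rewrite -(re1 (R := R) (k := k)); exact: re_le.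
have D1 : D 1 by exists y0; rewrite /= ?y01 // phi1 re1.
apply/eqP; rewrite eq_le ge_sup//=; last by exists 1.
by apply: sup_upper_bound => //; split; exists 1.
Qed.

Section NumericalRanges.
Context {R : realType} {k : scalar_kind} {X : completeNormedModType (scalars R k)}.
Local Notation K := (scalars R k).
Context (p : X -> R) (F : {linear X -> K^o}) (C d : R).
Context (pS : scalar_seminorm X p) (pn : forall x, p x <= re `|x|).
Context (p1 : forall x, re `|x| <= 1 -> p x < 1) (FC : forall x, re `|F x| <= C * re `|x|) (d0 : 0 < d).
Context (pd : forall e, 0 < e -> exists x, [/\ re `|x| <= 1, 1 - e < p x & d <= re `|F x|]).

Local Notation Y := (superspace p pS pn).
Local Notation incl := (linear_of _ _ _ _ (super_incl_linear p pS pn) : {linear X -> Y}).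
Local Notation op := (linear_of _ _ _ _ (super_op_linear p pS pn F) : {linear X -> Y}).

(** Test [phi] at [(x, s * c)], where [c] rotates [phi (0, 1)] to its modulus and
    [s = (1 - p x) / 2] is so small that the norm is still one. *)
Lemma num_range_zero z : num_range (restr_sphere incl) (restr_sphere op) z -> z = 0.
Proof.
move=> [phi [t [phi1 + ->]]]; rewrite /restr_sphere /=.
have phib := dual_norm_le _ _ _ phi phi1.2.
have : `|sval t| = 1 by have /set_mem := valP t.
move: (sval t) => x x1 phix.
pose lam := phi ((0, 1) : Y).
have [c [c1 cl]] := phase lam.
pose s := (1 - p x) / 2.
have px : p x < 1 by apply: p1; rewrite x1 re1.
have s0 : 0 < s by rewrite divr_gt0// subr_gt0.
have : re `|phi ((super_incl p pS pn x) + ((of_real s : K) * c) *: ((0, 1) : Y))| <= 1.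
  apply: le_trans (phib _) _; rewrite re_super_norm /super_norm ge_max /=.
  rewrite scaler0 addr0 add0r x1 re1 lexx /= -[_ *: 1]/(_ * 1) mulr1 normrM c1 mulr1 re_norm_of_real.
  by rewrite gtr0_norm// /s; lra.
rewrite linearD linearZ /= phix -[_ *: _]/(_ * _) -mulrA cl => h.
have : re (1 + of_real s * `|lam| : K) <= 1 by apply: le_trans h; apply: le_trans (ler_norm _) (re_le_norm _).
rewrite reD re1 reZ gerDl => h'.
have l0 : re `|lam| = 0.
  by apply/eqP; rewrite eq_le re_norm_ge0 andbT -(pmulr_rle0 _ s0).
have {}l0 : lam = 0 by exact: (@re_norm_eq0 R k K^o).
have -> : super_op p pS pn F x = (F x : K) *: ((0, 1) : Y).
  by congr pair; rewrite /= ?scaler0// -[_ *: 1]/(_ * 1) mulr1.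
by rewrite linearZ /= -/lam l0 scaler0.
Qed.

Lemma near_attaining e : 0 < e -> exists x, [/\ `|x| = 1, 1 - e < p x & d <= re `|F x|].
Proof.
move=> e0; have [x [x1 px Fx]] := pd e e0.
have nx0 : 0 < re `|x|.
  rewrite lt_neqAle re_norm_ge0 andbT eq_sym; apply/eqP => /re_norm_eq0 x0.
  by move: Fx; rewrite x0 linear0 normr0 re0 leNgt d0.
have n1 : 1 <= (re `|x|)^-1 by rewrite invf_ge1.
exists ((of_real (re `|x|)^-1 : K) *: x); split.
- rewrite normrZ -(norm_of_real _ x) -(norm_of_real _ (of_real _)) -of_realM.
  by rewrite re_norm_of_real re_of_real ger0_norm ?invr_ge0 ?(ltW nx0)// mulVf ?gt_eqF// of_real1.
- rewrite pS.2 re_norm_of_real ger0_norm ?invr_ge0 ?(ltW nx0)//; apply: lt_le_trans px _.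
  by rewrite ler_peMl//; exact: scalar_seminorm_ge0.
- rewrite linearZ /= normrM reM_norm re_norm_of_real ger0_norm ?invr_ge0 ?(ltW nx0)//.
  by apply: le_trans Fx _; rewrite ler_peMl// re_norm_ge0.
Qed.

(** [phi (y, a) = U y + lam * a] with [U] dominated by [p] and norming [x] for
    [p], and with [lam] of modulus one rotating [F x] to its modulus. *)
Lemma near_norming_functional x : `|x| = 1 -> exists phi : {linear Y -> K^o},
  [/\ dual_unit_sphere phi, re (phi (super_incl p pS pn x)) = p x & phi (super_op p pS pn F x) = `|F x|].
Proof.
move=> x1.
have [u [ul up ux]] := hahn_banach (p : realify R k X -> R) x
  (seminorm_sublinear _ (scalar_seminorm_real _ _ pS)).
have [U [Uu Up]] := complexify R k X p u pS ul up.
have [lam [lam1 lamF]] := phase (F x : K).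
pose f (y : Y) : K^o := U y.1 + lam *: y.2.
have fl : linear f.
  by move=> a y z; rewrite /f /= linearP scalerDr scalerDr addrACA scalerA mulrC -scalerA.
exists (linear_of _ _ _ _ fl); split.
- apply: (@dual_norm_eq1 _ _ Y _ ((0, 1) : Y)) => [y||].
  + rewrite re_super_norm; apply: le_trans (snd_super_norm p pS pn y).
    apply: le_trans (re_normD _ _ _) _; apply: lerD; first exact: Up.
    by rewrite normrM lam1 mul1r.
  + rewrite super_normE /super_norm /= normr0 re0 (seminorm_at0 p pS) add0r normr1 re1 max_r ?ler01//.
    exact: of_real1.
  + by rewrite /= /f /= linear0 add0r -[_ *: 1]/(_ * 1) mulr1.
- by rewrite /= /f /= scaler0 addr0 Uu ux.
- by rewrite /= /f /= linear0 add0r.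
Qed.

(** Along points [x n] with [p (x n)] tending to one, the values [|F (x n)|] are
    bounded and at least [d], hence have a cluster point [r >= d]. *)
Lemma approx_num_range_nonzero : exists2 z, z != 0 & approx_num_range (restr_sphere incl) (restr_sphere op) z.
Proof.
have /choice[x xP] : forall n : nat, exists x, [/\ `|x| = 1, 1 - n.+1%:R^-1 < p x & d <= re `|F x|].
  by move=> n; apply: near_attaining; rewrite invr_gt0.
have Fb n : `|re `|F (x n)| | <= C.
  rewrite ger0_norm ?re_norm_ge0//; have [x1 _ _] := xP n.
  by apply: le_trans (FC _) _; rewrite x1 re1 mulr1.
have [|B [r [_ Bu Br]]] := bounded_cvg_along setT (fun n => re `|F (x n)|) C _ Fb.
  by move=> N; exists N.
have dr : d <= r.
  apply/ler_addgt0Pl => e e0; have [N HN] := Br e e0; have [n [Nn Bn]] := Bu N.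
  have [_ _] := xP n; have := HN n Nn Bn; rewrite ler_norml => /andP[_]; lra.
exists (of_real r).
  rewrite -of_real0; apply/eqP => /(congr1 re); rewrite !re_of_real => r0.
  by have := lt_le_trans d0 dr; rewrite r0 ltxx.
move=> eps /= eps0 A /nbhs_ballP[e e0 eA].
have re0' : 0 < re e / 2.
  by rewrite divr_gt0// -(re0 (R := R) (k := k)); exact: re_lt.
have [N HN] := Br _ re0'.
have [n [Nn Bn]] := Bu (maxn N (Num.truncn eps^-1)).
have [x1 px _] := xP n.
have [phi [phi1 phix phiF]] := near_norming_functional _ x1.
exists (of_real (re `|F (x n)|)); split.
  exists phi, (SigSub (mem_set (x1 : unit_sphere X (x n)))); split=> //=.
    rewrite /restr_sphere /= phix; apply: le_lt_trans px; rewrite lerB//.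
    rewrite -[leRHS]invrK lef_pV2 ?posrE ?invr_gt0//; apply: ltW.
    apply: lt_le_trans (truncnS_gt _) _; rewrite ler_nat ltnS.
    by apply: leq_trans Nn; exact: leq_maxr.
  by rewrite /restr_sphere /= phiF norm_of_real.
apply: eA; rewrite -ball_normE /=.
have -> : of_real r - of_real (re `|F (x n)|) = of_real (r - re `|F (x n)|) :> K.
  by apply/eqP; rewrite subr_eq -of_realD subrK.
rewrite -norm_of_real re_norm_of_real -(ge0_of_real e (ltW e0)) ltr_of_real distrC.
have : re e / 2 < re e by lra.
apply: le_lt_trans; apply: HN => //; exact: leq_trans (leq_maxl _ _) Nn.
Qed.

End NumericalRanges.

Theorem mainTheorem6 (R : realType) (k : scalar_kind)
    (X : completeNormedModType (scalars R k)) :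
  ~ finite_dimensional X ->
  exists (Y : completeNormedModType (scalars R k))
         (i : {linear X -> Y}) (T : {linear X -> Y}),
    [/\ forall x : X, `|i x| = `|x|,
        hyperplane (range i),
        bounded_operator T &
        closure (num_range (restr_sphere i) (restr_sphere T))
          <> approx_num_range (restr_sphere i) (restr_sphere T)].
Proof.
move=> /exists_witness[p [F [C [d [pS pn p1 FC [d0 pd]]]]]].
exists (superspace p pS pn), (linear_of _ _ _ _ (super_incl_linear p pS pn)),
  (linear_of _ _ _ _ (super_op_linear p pS pn F)); split.
- exact: super_norm_incl.
- exact: super_hyperplane.
- exists (of_real C) => x /=.
  by rewrite super_norm_op -norm_of_real -(norm_of_real _ x) -of_realM ler_of_real.
have [z z0 zW] := approx_num_range_nonzero p F C d pS pn FC d0 pd.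
move=> E; rewrite -E in zW; move/eqP: z0; apply.
have cl : closed [set 0 : (scalars R k)^o].
  exact: (accessible_closed_set1 (hausdorff_accessible (@norm_hausdorff _ (scalars R k)^o))).
apply: cl; apply: closure_subset zW => w; exact: num_range_zero.
Qed.
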